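(* Let $p$ be a prime, let $G$ be a (possibly infinite) group that is pseudo finite at $p$, and let $\mathcal{C}\subseteq\mathcal{S}_p(G)$ be a non-empty collection of non-trivial finite $p$-subgroups of $G$ that is closed under $G$-conjugation and under passage to overgroups in $\mathcal{S}_p(G)$. Then the simplicial set $N(\mathcal{C})/G$ admits a Morse matching in which the set of critical cells consists of a single cell, of dimension $0$. Hence $N(\mathcal{C})/G$ is contractible.
   Context: Sylow subgroups and pseudo finite groups. Let $G$ be a (possibly infinite) group and $p$ a prime. A finite $p$-subgroup $S$ of $G$ is a Sylow $p$-subgroup of $G$ if every finite $p$-subgroup of $G$ is conjugate in $G$ to a subgroup of $S$. For a chain $\gamma=(P_0\le P_1\le\cdots\le P_n)$ of subgroups of $G$, its normalizer is $N_G(\gamma)=\bigcap_{i=0}^n N_G(P_i)$. The group $G$ is pseudo finite at $p$ if for every (finite) chain $\gamma$ of finite $p$-subgroups of $G$ (the trivial subgroup being allowed to appear in the chain), the group $N_G(\gamma)$ has a Sylow $p$-subgroup. Collections and nerves. $\mathcal{S}_p(G)$ is the poset, under inclusion, of all non-trivial finite $p$-subgroups of $G$. A subset $\mathcal{C}\subseteq\mathcal{S}_p(G)$ is closed under conjugation if $P\in\mathcal{C}$ and $g\in G$ imply $P^g=g^{-1}Pg\in\mathcal{C}$; it is closed under passage to overgroups if $P\in\mathcal{C}$, $Q\in\mathcal{S}_p(G)$ and $P\le Q$ imply $Q\in\mathcal{C}$. $N(\mathcal{C})$ denotes the nerve of the poset $\mathcal{C}$: the simplicial set whose $n$-simplices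 are the chains $(P_0\le\cdots\le P_n)$ in $\mathcal{C}$, with face maps $d_i$ deleting and degeneracy maps repeating the $i$-th entry. The conjugation action of $G$ on $\mathcal{C}$ is order preserving and extends to a simplicial action on $N(\mathcal{C})$; $N(\mathcal{C})/G$ is the quotient simplicial set whose $n$-simplices are the $G$-orbits of $n$-simplices of $N(\mathcal{C})$. A simplicial set is called contractible if its geometric realization is. Morse matchings. Let $X$ be a simplicial set; a cell of $X$ means a nondegenerate simplex. Suppose given (1) a partition of the cells of $X$ into critical, redundant and collapsible cells; (2) a bijection $c$ from the set of redundant cells to the set of collapsible cells such that for each redundant $n$-cell $\tau$, $c(\tau)$ is an $(n+1)$-cell and $\tau$ is a face of $c(\tau)$; (3) for each redundant $n$-cell $\tau$, a choice of index $\iota(\tau)\in\{0,1,\dots,n+1\}$ such that $\tau=d_{\iota(\tau)}(c(\tau))$, where $d_i$ is the $i$-th face map. Let $D$ be the digraph whose vertices are the redundant and collapsible cells and whose edges are $\tau\to c(\tau)$ for $\tau$ redundant, and $\sigma\to d_j(\sigma)$ for $\sigma$ collapsible and $j\neq\iota(c^{-1}(\sigma))$ (whenever $d_j(\sigma)$ is a vertex of $D$). These data form a Morse matching for $X$ if $D$ has no infinite directed path. *)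

(* Defs.v *)
From HB Require Import structures.
From Stdlib Require Import Relation_Operators.
From mathcomp Require Import all_boot all_order all_algebra.
From mathcomp Require Import all_classical all_reals all_analysis.
Set Implicit Arguments.
Unset Strict Implicit.
Unset Printing Implicit Defensive.
Import Order.TTheory GRing.Theory Num.Theory numFieldNormedType.Exports.
Local Open Scope classical_set_scope.

(* Subgroups of a possibly infinite group G are sets of elements of G. *)

Section groups.
Local Open Scope group_scope.
Variable G : groupType.
Implicit Types (P Q S N : set G) (C : set (set G)) (p : nat).

Definition subgroup P : Prop := group_closed [in P].

Definition fin_p_subgroup p P : Prop :=
  subgroup P /\ exists k : nat, (P #= `I_(p ^ k))%card.

Definition conj_set P (g : G) : set G := [set x ^ g | x in P].

Definition normalizer P : set G := [set g | conj_set P g = P].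

Definition is_chain n (P : 'I_n.+1 -> set G) : Prop :=
  forall i j : 'I_n.+1, (i <= j)%N -> P i `<=` P j.

Definition chain_normalizer n (P : 'I_n.+1 -> set G) : set G :=
  \bigcap_i normalizer (P i).

Definition sylow p N S : Prop :=
  [/\ fin_p_subgroup p S, S `<=` N &
      forall Q, fin_p_subgroup p Q -> Q `<=` N ->
        exists2 g, N g & conj_set Q g `<=` S].

Definition pseudo_finite_at p : Prop :=
  forall n (P : 'I_n.+1 -> set G),
    (forall i, fin_p_subgroup p (P i)) -> is_chain P ->
    exists S, sylow p (chain_normalizer P) S.

Definition Sp p : set (set G) :=
  [set P | fin_p_subgroup p P /\ P <> [set 1]].

Definition conj_closed C : Prop :=
  forall P (g : G), C P -> C (conj_set P g).

Definition overgroup_closed p C : Prop :=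
  forall P Q, C P -> Sp p Q -> P `<=` Q -> C Q.

Lemma conj_set1 P : conj_set P 1 = P.
Proof.
rewrite /conj_set; under eq_imagel do rewrite conjg1.
by rewrite image_id.
Qed.

Lemma conj_setM P (g h : G) : conj_set P (g * h) = conj_set (conj_set P g) h.
Proof.
rewrite /conj_set image_comp; apply: eq_imagel => x _ /=.
by rewrite conjgM.
Qed.

Lemma conj_setS P Q (g : G) : P `<=` Q -> conj_set P g `<=` conj_set Q g.
Proof. exact: image_subset. Qed.

End groups.

Arguments pseudo_finite_at : clear implicits.
Arguments Sp : clear implicits.

(* A simplicial set is a contravariant functor from the category of the
   ordinals [n] = 'I_n.+1 and their nondecreasing maps. *)

Record sset := SSet {
  simplex :> nat -> Type;
  smap : forall m n, {omorphism 'I_m.+1 -> 'I_n.+1} -> simplex n -> simplex m;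
  smap_id : forall n (x : simplex n), smap idfun x = x;
  smap_comp : forall l m n (f : {omorphism 'I_m.+1 -> 'I_n.+1})
      (g : {omorphism 'I_l.+1 -> 'I_m.+1}) (x : simplex n),
    smap (f \o g) x = smap g (smap f x) }.

HB.instance Definition _ (X : sset) n := gen_eqMixin (simplex X n).
HB.instance Definition _ (X : sset) n := gen_choiceMixin (simplex X n).

Definition coface n (i : 'I_n.+2) : 'I_n.+1 -> 'I_n.+2 := lift i.

Lemma coface_nondecreasing n (i : 'I_n.+2) :
  {homo coface i : j k / (j <= k)%O}.
Proof. by move=> j k; rewrite !leEord /= leq_bump2. Qed.

HB.instance Definition _ n (i : 'I_n.+2) :=
  Order.isOrderMorphism.Build _ _ _ _ (coface i) (@coface_nondecreasing n i).

Lemma codegeneracy_subproof n (i : 'I_n.+1) (j : 'I_n.+2) :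
  (unbump i j < n.+1)%N.
Proof.
rewrite /unbump; case: (ltnP i j) => /= ij; last first.
  by rewrite subn0 (leq_ltn_trans ij) // ltn_ord.
by rewrite subn1 prednK ?(leq_ltn_trans _ ij) // -ltnS ltn_ord.
Qed.

(* The nondecreasing surjection that takes the value i twice. *)
Definition codegeneracy n (i : 'I_n.+1) (j : 'I_n.+2) : 'I_n.+1 :=
  Ordinal (codegeneracy_subproof i j).

Lemma codegeneracy_nondecreasing n (i : 'I_n.+1) :
  {homo codegeneracy i : j k / (j <= k)%O}.
Proof.
move=> j k; rewrite !leEord /= /unbump => jk.
case: (ltnP i j) => ij; case: (ltnP i k) => ik //=; rewrite ?subn0 ?subn1.
- by rewrite -!subn1 leq_sub2r.
- by move: (leq_trans ij jk); rewrite ltnNge ik.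
- by rewrite (leq_trans ij) // -ltnS prednK // (leq_ltn_trans _ ik).
- exact: jk.
Qed.

HB.instance Definition _ n (i : 'I_n.+1) :=
  Order.isOrderMorphism.Build _ _ _ _ (codegeneracy i)
    (@codegeneracy_nondecreasing n i).

Definition face (X : sset) n (i : 'I_n.+2) (x : X n.+1) : X n :=
  smap (coface i) x.

Definition degeneracy (X : sset) n (i : 'I_n.+1) (x : X n) : X n.+1 :=
  smap (codegeneracy i) x.

Definition nondegenerate_simplex (X : sset) n : set (X n) :=
  match n with
  | 0 => setT
  | m.+1 => [set x | ~ exists (i : 'I_m.+1) (y : X m), x = degeneracy i y]
  end.
Arguments nondegenerate_simplex : clear implicits.

Section nerve.
Variables (G : groupType) (C : set (set G)).

Definition nerve_simplex n : Type :=
  {P : 'I_n.+1 -> set G | (forall i, C (P i)) /\ is_chain P}.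

Definition nerve_map m n (f : {omorphism 'I_m.+1 -> 'I_n.+1})
    (P : nerve_simplex n) : nerve_simplex m :=
  exist _ (sval P \o f)
    (conj (fun i => (svalP P).1 (f i))
          (fun i j ij => (svalP P).2 _ _ (omorph_le f ij))).

Lemma nerve_simplex_inj n (P Q : nerve_simplex n) : sval P = sval Q -> P = Q.
Proof. by case: P Q => [P hP] [Q hQ] /= PQ; exact: eq_exist. Qed.

Definition nerve : sset.
Proof.
refine (@SSet nerve_simplex nerve_map _ _).
- by move=> n P; apply: nerve_simplex_inj.
- by move=> l m n f g P; apply: nerve_simplex_inj.
Defined.

End nerve.

Section orbits.
Local Open Scope group_scope.

Record sset_action (G : groupType) (X : sset) := SSetAction {
  sact : forall n, X n -> G -> X n;
  sact1 : forall n (x : X n), sact x 1 = x;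
  sactM : forall n (x : X n) (g h : G), sact x (g * h) = sact (sact x g) h;
  sact_smap : forall m n (f : {omorphism 'I_m.+1 -> 'I_n.+1}) (x : X n) (g : G),
    smap f (sact x g) = sact (smap f x) g }.

Section quotient.
Variables (G : groupType) (X : sset) (a : sset_action G X).

Definition sorbit n (x : X n) : set (X n) := range (sact a x).

Definition sorbits n : Type := {O : set (X n) | exists x, O = sorbit x}.

Lemma sorbits_map_subproof m n (f : {omorphism 'I_m.+1 -> 'I_n.+1})
    (O : sorbits n) : exists x, smap f @` sval O = sorbit x.
Proof.
case: O => /= _ [x ->]; exists (smap f x).
rewrite /sorbit image_comp; apply: eq_imagel => g _ /=.
exact: sact_smap.
Qed.

Definition sorbits_map m n (f : {omorphism 'I_m.+1 -> 'I_n.+1})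
    (O : sorbits n) : sorbits m :=
  exist _ (smap f @` sval O) (sorbits_map_subproof f O).

Lemma sorbits_inj n (A B : sorbits n) : sval A = sval B -> A = B.
Proof. by case: A B => [A hA] [B hB] /= AB; exact: eq_exist. Qed.

Definition quotient_sset : sset.
Proof.
refine (@SSet sorbits sorbits_map _ _).
- move=> n O; apply: sorbits_inj => /=.
  by under eq_imagel do rewrite smap_id; rewrite image_id.
- move=> l m n f g O; apply: sorbits_inj => /=.
  by rewrite image_comp; apply: eq_imagel => x _ /=; rewrite smap_comp.
Defined.

End quotient.

Section nerve_action.
Variables (G : groupType) (C : set (set G)) (Cconj : conj_closed C).

Definition nerve_conj n (P : nerve C n) (g : G) : nerve C n :=
  exist _ (fun i => conj_set (sval P i) g)
    (conj (fun i => Cconj g ((svalP P).1 i))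
          (fun i j ij => conj_setS (g := g) ((svalP P).2 i j ij))).

Definition nerve_action : sset_action G (nerve C).
Proof.
refine (@SSetAction G (nerve C) nerve_conj _ _ _).
- move=> n P; apply: nerve_simplex_inj; apply/funext => i /=.
  exact: conj_set1.
- move=> n P g h; apply: nerve_simplex_inj; apply/funext => i /=.
  exact: conj_setM.
- by move=> m n f P g; apply: nerve_simplex_inj.
Defined.

Definition nerve_quotient : sset := quotient_sset nerve_action.

End nerve_action.

End orbits.

(* [mate] is the bijection c and [mate_index] is iota; outside the redundant
   cells their values are irrelevant. As c raises the dimension by one and is
   onto the collapsible cells, it is a bijection in each dimension and there
   is no collapsible 0-cell. *)
Record matching (X : sset) := Matching {
  critical : forall n, set (X n);
  redundant : forall n, set (X n);
  collapsible : forall n, set (X n);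
  mate : forall n, X n -> X n.+1;
  mate_index : forall n, X n -> 'I_n.+2;
  matching_cover : forall n,
    @critical n `|` @redundant n `|` @collapsible n = nondegenerate_simplex X n;
  matching_disjoint : forall n,
    [/\ @critical n `&` @redundant n = set0,
        @critical n `&` @collapsible n = set0 &
        @redundant n `&` @collapsible n = set0];
  collapsible0 : @collapsible 0 = set0;
  mate_bij : forall n, set_bij (@redundant n) (@collapsible n.+1) (@mate n);
  mate_face : forall n (x : X n), redundant x ->
    face (mate_index x) (mate x) = x }.

Section morse.
Variables (X : sset) (M : matching X).

Definition critical_cells : set {n & X n} :=
  [set s | critical M (projT2 s)].

Inductive morse_edge : {n & X n} -> {n & X n} -> Prop :=
| edge_up n (x : X n) :
    redundant M x ->
    morse_edge (existT _ n x) (existT _ n.+1 (mate M x))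
| edge_down n (x : X n) (y : X n.+1) (j : 'I_n.+2) :
    redundant M x -> y = mate M x -> j != mate_index M x ->
    redundant M (face j y) \/ collapsible M (face j y) ->
    morse_edge (existT _ n.+1 y) (existT _ n (face j y)).

Definition morse_matching : Prop :=
  ~ exists s : nat -> {n & X n}, forall k, morse_edge (s k) (s k.+1).

End morse.

Section realization.
Local Open Scope ring_scope.
Variable R : realType.

Definition std_simplex n : set 'rV[R]_n.+1 :=
  [set t | (forall i, 0 <= t 0 i) /\ \sum_i t 0 i = 1].
Arguments std_simplex : clear implicits.

Definition push_row m n (f : 'I_m.+1 -> 'I_n.+1) (t : 'rV[R]_m.+1) :
    'rV[R]_n.+1 :=
  \row_j \sum_(i | f i == j) t 0 i.

Lemma push_row_subproof m n (f : 'I_m.+1 -> 'I_n.+1) (t : std_simplex m) :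
  push_row f (set_val t) \in std_simplex n.
Proof.
have [t0 t1] := set_valP t; apply/mem_set; split.
  by move=> j; rewrite mxE sumr_ge0.
rewrite -[RHS]t1 [RHS](partition_big f predT) //=.
by apply: eq_bigr => j _; rewrite mxE.
Qed.

Definition push_simplex m n (f : 'I_m.+1 -> 'I_n.+1) (t : std_simplex m) :
    std_simplex n :=
  exist _ (push_row f (set_val t)) (push_row_subproof f t).

Variable X : sset.

(* The disjoint union over all simplices x of X of a copy of the standard
   simplex of the dimension of x. *)
Definition prerealization : Type :=
  {s : {n & X n} & std_simplex (projT1 s)}.

HB.instance Definition _ := Topological.on prerealization.

Inductive realization_step : prerealization -> prerealization -> Prop :=
| Realization_step m n (f : {omorphism 'I_m.+1 -> 'I_n.+1}) (x : X n)
    (t : std_simplex m) :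
    realization_step (existT _ (existT _ m (smap f x)) t)
                     (existT _ (existT _ n x) (push_simplex f t)).

Definition realization_rel (u v : prerealization) : bool :=
  `[< clos_refl_sym_trans _ realization_step u v >].

Lemma realization_rel_refl : reflexive realization_rel.
Proof. by move=> u; apply/asboolP; exact: rst_refl. Qed.

Lemma realization_rel_sym : symmetric realization_rel.
Proof.
by move=> u v; apply/idP/idP => /asboolP h; apply/asboolP; exact: rst_sym.
Qed.

Lemma realization_rel_trans : transitive realization_rel.
Proof.
move=> v u w /asboolP uv /asboolP vw; apply/asboolP.
exact: rst_trans uv vw.
Qed.

Definition realization_equiv :=
  EquivRel realization_rel realization_rel_refl realization_rel_sym
    realization_rel_trans.

Definition realization : topologicalType :=
  quotient_topology {eq_quot realization_equiv}%qT.

Definition contractible (Y : topologicalType) : Prop :=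
  exists (y0 : Y) (H : Y * R -> Y),
    [/\ {within [set: Y] `*` `[0, 1], continuous H},
        forall y, H (y, 0) = y & forall y, H (y, 1) = y0].

End realization.

Arguments std_simplex : clear implicits.

Definition sset_contractible (R : realType) (X : sset) : Prop :=
  contractible R (realization R X).

(* Main.v *)
(* A chain Z of p-subgroups has a largest member K normalizing all the members
   of Z below it. Let M be the group of the elements that normalize the members
   of Z inside K and lie in all the others. The members of Z are normalized by
   M, so a Sylow p-subgroup Q of M is unique up to conjugations fixing Z, and
   it contains K. If Q <> K then Z is matched with Z + {Q}; conversely, as
   normalizers grow in finite p-groups, if Q = K and Z <> {K} then K is a Sylow
   subgroup of the group M attached to Z - {K}. The only critical orbit is that
   of the chain consisting of a Sylow p-subgroup of G. Following an edge of the
   digraph never decreases |K|, and going up increases it, whence there are no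
   infinite paths.
   For contractibility, a point of the realization is an orbit of chains with
   barycentric weights. It flows at unit speed from its simplex (completed by
   Q) towards the vertex Q until some other weight vanishes, and then starts
   again from the smaller chain. The same measure bounds the number of steps,
   and shows by induction that the flow is continuous on closed simplices. *)
From HB Require Import structures.
From Stdlib Require Import Relation_Operators.
Require Import Defs.
From mathcomp Require Import all_boot all_order all_algebra finmap.
From mathcomp Require Import all_fingroup all_solvable.
From mathcomp Require Import all_classical all_reals all_analysis.
From mathcomp Require Import zify.
Set Implicit Arguments.
Unset Strict Implicit.
Unset Printing Implicit Defensive.
Local Open Scope classical_set_scope.
Local Open Scope group_scope.

(** * Finite p-subgroups *)

(** The obstacle behind the set-up is that the subgroup inserted into a chain is only known up to
    conjugation. Every choice made along the way, of an apex or of a representative of an orbit,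
    therefore has to be shown harmless by an explicit conjugating element; in the flow these
    elements accumulate, one for each restart. For the topology, a member of a chain is labelled by
    the exponent of its order, a power of p. This label is invariant under conjugation, strictly
    increases along strict chains and is bounded by that of a Sylow subgroup of G, into which every
    member can be conjugated. Hence the weights of all strict chains live in one fixed vector space,
    and inserting or deleting a member renumbers nothing. The contraction is written down explicitly
    instead of being derived from the matching: inserting Q joins the simplex to one more vertex, so
    a straight motion towards this vertex stays in a simplex of the quotient. *)

Section subgroups.
Variables (G : groupType) (P : set G).
Hypothesis PG : subgroup P.

Lemma subgroup1 : P 1. Proof. by apply/set_mem; exact: PG.1. Qed.

Lemma subgroupM x y : P x -> P y -> P (x * y).
Proof.
by move=> /mem_set Px /mem_set Py; apply/set_mem/(group_closedM PG Px Py).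
Qed.

Lemma subgroupV x : P x -> P x^-1.
Proof. by move=> /mem_set Px; apply/set_mem/(group_closedV PG Px). Qed.

End subgroups.

Section seq_group.
Variables (G : groupType) (s : seq G).

(** The closure proof is an argument so that a finite group structure can be attached to the type;
    this opens the theory of finite groups to finite subgroups of [G]. *)
Definition seq_group of group_closed [in s] : Type := seq_sub s.

Variable sG : group_closed [in s].
HB.instance Definition _ := Finite.on (seq_group sG).
HB.instance Definition _ := SubType.on (seq_group sG).

Definition seq_group_one : seq_group sG := SeqSub sG.1.

Definition seq_group_mul (x y : seq_group sG) : seq_group sG :=
  SeqSub (group_closedM sG (ssvalP x) (ssvalP y)).

Definition seq_group_inv (x : seq_group sG) : seq_group sG :=
  SeqSub (group_closedV sG (ssvalP x)).

Lemma seq_group_mulA : associative seq_group_mul.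
Proof. by move=> x y z; apply: val_inj; exact: mulgA. Qed.

Lemma seq_group_mul1 : left_id seq_group_one seq_group_mul.
Proof. by move=> x; apply: val_inj; exact: mul1g. Qed.

Lemma seq_group_mulV : left_inverse seq_group_one seq_group_inv seq_group_mul.
Proof. by move=> x; apply: val_inj; exact: mulVg. Qed.

HB.instance Definition _ := Finite_isGroup.Build (seq_group sG)
  seq_group_mulA seq_group_mul1 seq_group_mulV.

Definition seq_group_set (H : set G) : {set seq_group sG} :=
  [set x | `[< H (val x) >]]%SET.

Lemma seq_group_setP H x : reflect (H (val x)) (x \in seq_group_set H).
Proof. by rewrite finset.in_set; exact: asboolP. Qed.

Lemma seq_group_set_group H : subgroup H -> group_set (seq_group_set H).
Proof.
move=> HG; apply/group_setP; split.
  by apply/seq_group_setP; exact: (subgroup1 HG).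
move=> x y /seq_group_setP Hx /seq_group_setP Hy.
by apply/seq_group_setP; exact: (subgroupM HG Hx Hy).
Qed.

Lemma card_seq_group_set H : H `<=` [set` s] ->
  (H #= `I_#|seq_group_set H|)%card.
Proof.
move=> Hs; set A := seq_group_set H.
have -> : H = val @` [set x | x \in A].
  apply/seteqP; split => [x Hx|_ [x /= + <-]]; last exact/seq_group_setP.
  by exists (SeqSub (Hs _ Hx)) => //=; exact/seq_group_setP.
apply: (card_eq_trans (inj_card_eq (in2W val_inj))).
have -> : [set x | x \in A] = [set` [fset x in enum A]%fset].
  by apply/seteqP; split=> x /=; rewrite in_fset mem_enum.
apply/card_eq_fsetP; rewrite card_fseq undup_id ?enum_uniq //.
by rewrite cardE.
Qed.

End seq_group.

Section finite_p_subgroups.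
Variables (G : groupType) (p : nat).
Hypothesis p_prime : prime p.
Implicit Types (P Q H T : set G).

Lemma fin_p_seq T : fin_p_subgroup p T -> exists2 s, T = [set` s] &
  exists sG : group_closed [in s], exists k,
    #|[set: seq_group sG]%SET| = (p ^ k)%N.
Proof.
case=> TG [k Tk]; have [s Ts] : exists s : seq G, T = [set` s].
  by apply/finite_seqP/finite_setP; exists (p ^ k)%N.
have sG : group_closed [in s].
  have sT x : (x \in s) = (x \in T) by rewrite Ts; apply/idP/idP; rewrite inE.
  case: TG => T1 TB; split; first by rewrite sT.
  by move=> x y; rewrite !sT; exact: TB.
exists s => //; exists sG, k; have := @card_seq_group_set _ _ sG T.
rewrite Ts => /(_ (@subset_refl _ _)); rewrite -Ts.
have -> : seq_group_set sG T = [set: seq_group sG]%SET.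
  apply/setP=> x; rewrite finset.in_setT; apply/seq_group_setP.
  by rewrite Ts; exact: (ssvalP x).
move=> Tc; apply/card_eq_II; rewrite -(card_eqr Tk); rewrite card_eq_sym //.
Qed.

Lemma fin_p_sub T H : fin_p_subgroup p T -> subgroup H -> H `<=` T ->
  fin_p_subgroup p H.
Proof.
move=> /fin_p_seq[s -> [sG [k sk]]] HG Hs; split=> //.
have := card_seq_group_set sG Hs.
have : #|seq_group_set sG H| %| p ^ k.
  rewrite -sk.
  exact: (cardSg (H := Group (seq_group_set_group sG HG)) (finset.subsetT _)).
by case/(dvdn_pfactor _ _ p_prime) => j _ -> ?; exists j.
Qed.

(** Finite p-groups are nilpotent, and in a nilpotent group a proper subgroup is proper in its
    normalizer. *)
Lemma fin_p_normalizer_grows T P : fin_p_subgroup p T -> subgroup P ->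
  P `<=` T -> P <> T ->
  exists2 x, (T `&` normalizer P) x & ~ P x.
Proof.
move=> /fin_p_seq[s -> [sG [k sk]]] PG Ps PT.
pose P' := Group (seq_group_set_group sG PG).
have sP' : P' \proper [set: seq_group sG]%SET.
  rewrite finset.properEneq finset.subsetT andbT; apply/eqP => PT'; apply: PT.
  apply/seteqP; split => // x xs.
  by have /seq_group_setP : SeqSub xs \in P' by rewrite PT' finset.in_setT.
have nil : nilpotent [set: seq_group sG]%SET.
  by apply: (@pgroup_nil _ p); rewrite /pgroup sk pnatX pnat_id.
have /properP[_ [x /setIP[_ /normP nx] Px]] := nilpotent_proper_norm nil sP'.
exists (val x); last by move=> /seq_group_setP; exact/negP.
split; first exact: ssvalP.
apply/seteqP; split => [_ [y Py <-]|y Py].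
- pose z : seq_group sG := SeqSub (Ps _ Py).
  have : z ^ x \in P' :^ x by rewrite memJ_conjg; exact/seq_group_setP.
  by rewrite nx => /seq_group_setP.
- pose z : seq_group sG := SeqSub (Ps _ Py).
  have : z \in P' :^ x by rewrite nx; exact/seq_group_setP.
  by case/imsetP => t /seq_group_setP tP /(congr1 val) zt; exists (val t).
Qed.

End finite_p_subgroups.

Section conj_sets.
Variable G : groupType.
Implicit Types (P Q N : set G) (g h x : G).

Lemma conj_setP P g x : conj_set P g x <-> P (x ^ g^-1).
Proof.
split => [[y Py <-]|Px]; first by rewrite conjgK.
by exists (x ^ g^-1) => //; rewrite conjgKV.
Qed.

Lemma conj_setK P g : conj_set (conj_set P g) g^-1 = P.
Proof. by rewrite -conj_setM mulgV conj_set1. Qed.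

Lemma conj_setVK P g : conj_set (conj_set P g^-1) g = P.
Proof. by rewrite -conj_setM mulVg conj_set1. Qed.

Lemma conj_set_inj g : injective (fun P => conj_set P g).
Proof. by move=> P Q PQ; rewrite -(conj_setK P g) PQ conj_setK. Qed.

Lemma conj_setSE P Q g : conj_set P g `<=` conj_set Q g <-> P `<=` Q.
Proof.
split; last exact: conj_setS.
by move=> /(@conj_setS _ _ _ g^-1); rewrite !conj_setK.
Qed.

Lemma conj_setSV P Q g : conj_set P g `<=` Q <-> P `<=` conj_set Q g^-1.
Proof. by rewrite -(@conj_setSE _ _ g^-1) conj_setK. Qed.

Lemma subgroup_conj P g : subgroup P -> subgroup (conj_set P g).
Proof.
move=> PG; split.
  by apply/mem_set/conj_setP; rewrite conj1g; exact: (subgroup1 PG).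
move=> x y /set_mem/conj_setP Px /set_mem/conj_setP Py.
apply/mem_set/conj_setP; rewrite conjMg conjVg.
exact: (subgroupM PG Px (subgroupV PG Py)).
Qed.

Lemma subgroupI P Q : subgroup P -> subgroup Q -> subgroup (P `&` Q).
Proof.
move=> PG QG; split.
  by apply/mem_set; split; [exact: (subgroup1 PG)|exact: (subgroup1 QG)].
move=> x y /set_mem[Px Qx] /set_mem[Py Qy]; apply/mem_set; split.
- exact: (subgroupM PG Px (subgroupV PG Py)).
- exact: (subgroupM QG Qx (subgroupV QG Qy)).
Qed.

Lemma conj_set_id P g : subgroup P -> P g -> conj_set P g = P.
Proof.
move=> PG Pg; apply/seteqP; split => [_ [x Px <-]|x Px].
  exact: (subgroupM PG (subgroupV PG Pg) (subgroupM PG Px Pg)).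
apply/conj_setP; rewrite conjgE invgK.
exact: (subgroupM PG Pg (subgroupM PG Px (subgroupV PG Pg))).
Qed.

Lemma subgroup_normalizer P : subgroup (normalizer P).
Proof.
split; first by apply/mem_set; exact: conj_set1.
move=> x y /set_mem Px /set_mem Py; apply/mem_set.
by rewrite /normalizer /= conj_setM Px -{1}Py conj_setK.
Qed.

Lemma normalizer_conj P g :
  normalizer (conj_set P g) = conj_set (normalizer P) g.
Proof.
have E x : normalizer (conj_set P g) x <-> normalizer P (x ^ g^-1).
  rewrite /normalizer /= conjgE invgK -!conj_setM.
  split => E; first by rewrite mulgA conj_setM E conj_setK.
  by rewrite -{2}E -conj_setM !mulgA mulgVK.
by apply/seteqP; split=> x; [move/E/conj_setP|move/conj_setP/E].
Qed.

End conj_sets.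

(** * Sylow subgroups of possibly infinite groups *)

Section sylow.
Variables (G : groupType) (p : nat).
Hypothesis p_prime : prime p.
Implicit Types (P Q R N : set G) (g : G).

Definition lg P : nat := xget 0%N [set k | (P #= `I_(p ^ k))%card].

Lemma lgP P : fin_p_subgroup p P -> (P #= `I_(p ^ lg P))%card.
Proof. by case=> _ kP; exact: (xgetPex 0%N kP). Qed.

Lemma fin_p_conj P g : fin_p_subgroup p P -> fin_p_subgroup p (conj_set P g).
Proof.
case=> PG [k Pk]; split; first exact: subgroup_conj.
exists k; apply: card_eq_trans Pk; apply: inj_card_eq => x y _ _.
exact: conjg_inj.
Qed.

Lemma fin_p_lg_le P Q : fin_p_subgroup p P -> fin_p_subgroup p Q ->
  P `<=` Q -> (lg P <= lg Q)%N.
Proof.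
move=> /lgP Pk /lgP Qk /subset_card_le.
rewrite (card_le_eql Pk) (card_le_eqr Qk) card_le_II.
by rewrite leq_exp2l // prime_gt1.
Qed.

Lemma fin_p_lg_eq P Q : fin_p_subgroup p P -> fin_p_subgroup p Q ->
  P `<=` Q -> (lg Q <= lg P)%N -> P = Q.
Proof.
move=> Pp Qp PQ QP; have {}QP : lg P = lg Q.
  by apply/eqP; rewrite eqn_leq QP fin_p_lg_le.
have fP : finite_set P by apply/finite_setP; eexists; exact: lgP.
have fQ : finite_set Q by apply/finite_setP; eexists; exact: lgP.
apply/(fset_set_inj fP fQ)/eqP.
rewrite eqEfcard; apply/andP; split; first by rewrite -fset_set_sub.
by rewrite (card_fset_set (lgP Pp)) (card_fset_set (lgP Qp)) QP.
Qed.

Lemma lg_conj P g : lg (conj_set P g) = lg P.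
Proof.
rewrite /lg; congr xget; apply/funext => k /=; congr is_true.
by apply: card_eql; apply: inj_card_eq => x y _ _; exact: conjg_inj.
Qed.

(** A conjugate of [R] lies in [Q], so [R] cannot be larger than [Q]. *)
Lemma sylow_max N Q R : sylow p N Q -> fin_p_subgroup p R -> R `<=` N ->
  Q `<=` R -> R = Q.
Proof.
case=> Qp _ QS Rp /(QS _ Rp)[g _ RQ] QR; apply/esym/fin_p_lg_eq => //.
by rewrite -(lg_conj R g); apply: fin_p_lg_le => //; exact: fin_p_conj.
Qed.

Lemma sylow_conj N Q g : sylow p N Q -> sylow p (conj_set N g) (conj_set Q g).
Proof.
case=> Qp QN QS; split; [exact: fin_p_conj|exact: conj_setS|].
move=> R Rp RN; have [|h Nh RQ] := QS (conj_set R g^-1) (fin_p_conj _ Rp).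
  by apply/conj_setSV; rewrite invgK.
exists (h ^ g); first by exists h.
by rewrite conjgE !conj_setM; exact: conj_setS.
Qed.

Lemma sylow_uniq N Q R : subgroup N -> sylow p N Q -> sylow p N R ->
  exists2 g, N g & conj_set Q g = R.
Proof.
move=> NG [Qp QN QS] [Rp RN RS].
have [g Ng gR] := RS _ Qp QN; have [h Nh hQ] := QS _ Rp RN.
exists g => //; apply: fin_p_lg_eq => //; first exact: fin_p_conj.
rewrite lg_conj -(lg_conj R h); apply: fin_p_lg_le => //; exact: fin_p_conj.
Qed.

Lemma sylow_conj_in N Q g : subgroup N -> N g -> sylow p N Q ->
  sylow p N (conj_set Q g).
Proof. by move=> NG Ng /(sylow_conj g); rewrite conj_set_id. Qed.

Lemma sylow_refl N : fin_p_subgroup p N -> sylow p N N.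
Proof.
move=> Np; split=> // Q _ QN; exists 1; first exact: (subgroup1 Np.1).
by rewrite conj_set1.
Qed.

End sylow.

(** The chain with the trivial subgroup as its only term has normalizer [G]. *)
Lemma pseudo_finite_sylow (G : groupType) p : pseudo_finite_at G p ->
  exists S, sylow p [set: G] S.
Proof.
pose P (_ : 'I_1) : set G := [set 1].
have P1 i : fin_p_subgroup p (P i).
  split; last by exists 0%N; rewrite expn0; exact: card_set1.
  split; first by rewrite inE.
  by move=> x y /set_mem -> /set_mem ->; rewrite mulgV inE.
move=> /(_ 0%N P P1 (fun _ _ _ _ => id))[S Ss]; exists S.
suff <- : chain_normalizer P = [set: G] by [].
apply/seteqP; split => // g _ i _; rewrite /normalizer /conj_set /=.
by rewrite image_set1 conj1g.
Qed.

(** * Chains of subgroups *)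

Section chains.
Variables (G : groupType).
Implicit Types (P Q K L T S N : set G) (Z W : set (set G)) (g : G).

Definition conjs Z g : set (set G) := (fun P => conj_set P g) @` Z.

Definition prefix_normal Z K : Prop :=
  forall P, Z P -> P `<=` K -> K `<=` normalizer P.

Definition is_top Z K : Prop :=
  [/\ Z K, prefix_normal Z K &
      forall P, Z P -> prefix_normal Z P -> P `<=` K].

(** The second condition keeps every subgroup of [stab Z K] inside the members not contained in [K],
    so that a Sylow subgroup can be inserted below them; by the first it normalizes the members that
    it will contain. *)
Definition stab Z K : set G :=
  [set g | (forall P, Z P -> P `<=` K -> normalizer P g) /\
           (forall L, Z L -> ~ L `<=` K -> L g)].

Lemma conjsP Z g P : conjs Z g P <-> Z (conj_set P g^-1).
Proof.
split => [[Q ZQ <-]|ZP]; first by rewrite conj_setK.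
by exists (conj_set P g^-1) => //; rewrite conj_setVK.
Qed.

Lemma conjs_conj Z g P : conjs Z g (conj_set P g) <-> Z P.
Proof. by rewrite conjsP conj_setK. Qed.

Lemma conjsK Z g : conjs (conjs Z g) g^-1 = Z.
Proof.
by apply/seteqP; split=> P; [move/conjsP|move=> ZP; apply/conjsP];
  rewrite invgK ?conjs_conj.
Qed.

Lemma prefix_normal_conj Z K g :
  prefix_normal Z K -> prefix_normal (conjs Z g) (conj_set K g).
Proof.
move=> ZK _ [P ZP <-] /conj_setSE PK; rewrite normalizer_conj.
exact/conj_setS/ZK.
Qed.

Lemma prefix_normal_conjE Z K g :
  prefix_normal (conjs Z g) (conj_set K g) <-> prefix_normal Z K.
Proof.
split; last exact: prefix_normal_conj.
by move=> /(@prefix_normal_conj _ _ g^-1); rewrite conjsK conj_setK.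
Qed.

Lemma is_top_conj Z K g : is_top Z K -> is_top (conjs Z g) (conj_set K g).
Proof.
case=> ZK nK mK; split; [exact/conjs_conj|exact: prefix_normal_conj|].
by move=> _ [P ZP <-] /prefix_normal_conjE /(mK _ ZP) PK; exact: conj_setS.
Qed.

Lemma stab_conj Z K g : stab (conjs Z g) (conj_set K g) = conj_set (stab Z K) g.
Proof.
apply/seteqP; split => x.
  case=> xN xL; apply/conj_setP; split=> [P ZP PK|L ZL LK].
  - apply/conj_setP; rewrite -normalizer_conj.
    by apply: xN; [exact/conjs_conj|exact: conj_setS].
  - apply/conj_setP; apply: xL; first exact/conjs_conj.
    by move=> /conj_setSE.
move=> /conj_setP[xN xL]; split => [_ [P ZP <-] /conj_setSE PK|].
  by rewrite normalizer_conj; apply/conj_setP; exact: xN.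
by move=> _ [L ZL <-] LK; apply/conj_setP; apply: xL => // /conj_setSE.
Qed.

Lemma is_top_uniq Z K K' : is_top Z K -> is_top Z K' -> K = K'.
Proof.
by move=> [ZK nK mK] [ZK' nK' mK']; apply/seteqP; split;
  [exact: mK'|exact: mK].
Qed.

Lemma is_top_sub Z W K K' : is_top Z K -> W `<=` Z -> W K -> is_top W K' ->
  K `<=` K'.
Proof.
move=> [ZK nK _] WZ WK [_ _]; apply => // P WP.
by apply: nK; exact: WZ.
Qed.

End chains.

Lemma card_ltn_ord n i : (i <= n)%N -> #|[pred j : 'I_n | (j < i)%N]| = i.
Proof.
by move=> le_in; rewrite -sum1_card (big_ord_narrow le_in) sum1_card card_ord.
Qed.

(** * Orbits of chains as cells, and insertion of a member into a chain *)

Section quotient_cells.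
Variables (G : groupType) (C : set (set G)) (Cconj : conj_closed C).
Notation X := (nerve_quotient Cconj).

Definition class n (x : nerve C n) : X n :=
  exist _ (sorbit (nerve_action Cconj) x) (ex_intro _ x erefl).

Lemma classP n (O : X n) : exists x, O = class x.
Proof. by case: O => O [x Ox]; exists x; apply: sorbits_inj. Qed.

Lemma class_conj n (x : nerve C n) g : class (nerve_conj Cconj x g) = class x.
Proof.
apply: sorbits_inj => /=; apply/seteqP; split=> _ [h _ <-].
  by exists (g * h) => //; exact: (sactM (nerve_action Cconj)).
exists (g^-1 * h) => //.
transitivity (sact (nerve_action Cconj) x (g * (g^-1 * h))).
  exact: esym (sactM (nerve_action Cconj) x g (g^-1 * h)).
by rewrite mulKVg.
Qed.

Lemma class_eq n (x y : nerve C n) : class x = class y ->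
  exists g, y = nerve_conj Cconj x g.
Proof.
move=> /(congr1 sval)/= xy.
have : sorbit (nerve_action Cconj) y y.
  by exists 1 => //; exact: (sact1 (nerve_action Cconj)).
by rewrite -xy => -[g _ <-]; exists g.
Qed.

Lemma smap_class m n (f : {omorphism 'I_m.+1 -> 'I_n.+1}) (x : nerve C n) :
  smap f (class x) = class (smap f x).
Proof.
apply: sorbits_inj => /=; rewrite /sorbit image_comp.
apply: eq_imagel => g _ /=.
exact: (sact_smap (nerve_action Cconj)).
Qed.

Lemma face_class n i (x : nerve C n.+1) : face i (class x) = class (face i x).
Proof. exact: smap_class. Qed.

Lemma sval_face n i (x : nerve C n.+1) j :
  sval (face i x) j = sval x (lift i j).
Proof. by []. Qed.

Definition rng n (x : nerve C n) : set (set G) := range (sval x).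

Lemma rng_conj n (x : nerve C n) g :
  rng (nerve_conj Cconj x g) = conjs (rng x) g.
Proof. by rewrite /rng /conjs image_comp. Qed.

Lemma inj_conj n (x : nerve C n) g :
  injective (sval x) -> injective (sval (nerve_conj Cconj x g)).
Proof. by move=> xI i j /conj_set_inj/xI. Qed.

(** Degeneracies commute with taking orbits, and conjugation preserves repetitions, so degeneracy
    can be read off from any representative. *)
Lemma degenerateP n (x : nerve C n.+1) :
  (exists (i : 'I_n.+1) (O : X n), class x = degeneracy i O) <->
  ~ injective (sval x).
Proof.
split.
  move=> [i]; case=> w; have [z ->] := classP w; rewrite /degeneracy smap_class.
  move=> /esym/class_eq[g ->] xI.
  have lt1 : (i < n.+2)%N := leqW (ltn_ord i).
  have lt2 : (i.+1 < n.+2)%N := ltn_ord i.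
  have /(congr1 val)/=/eqP : Ordinal lt1 = Ordinal lt2.
    apply: xI => /=; congr (conj_set (sval z _) g); apply: val_inj => /=.
    by rewrite /unbump ltnn ltnSn subn0 subn1.
  by rewrite ltn_eqF.
move=> xI.
have [j [k [jk xjk]]] : exists j k : 'I_n.+2, (j < k)%N /\ sval x j = sval x k.
  apply: contrapT => no; apply: xI => j k xjk; apply: val_inj.
  by case: (ltngtP j k) => // jk; exfalso; apply: no;
    [exists j, k|exists k, j].
have xch := (svalP x).2.
have lti : (j < n.+1)%N by apply: leq_trans jk _; rewrite -ltnS.
have lti1 : (j.+1 < n.+2)%N by rewrite ltnS.
pose i := Ordinal lti; pose i1 : 'I_n.+2 := Ordinal lti1.
(* The entry following [j] is squeezed between the equal entries at [j] and [k]. *)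
have xj1 : sval x i1 = sval x j.
  apply/seteqP; split; last by apply: xch; exact: leqnSn.
  by rewrite xjk; exact: xch.
exists i, (class (face i1 x)); rewrite /degeneracy smap_class; congr class.
apply: nerve_simplex_inj; apply/funext => l /=.
have [->|li1] := eqVneq l i1.
  rewrite xj1; congr (sval x _); apply: val_inj => /=.
  by rewrite /unbump ltnSn subn1 /= /bump ltnn.
congr (sval x _); apply: val_inj => /=.
have {}li1 : (l : nat) != j.+1.
  by apply: contra li1 => /eqP li1; exact/eqP/val_inj.
by rewrite /unbump /bump; lia.
Qed.

Lemma nondegenerateP n (x : nerve C n) :
  nondegenerate_simplex X n (class x) <-> injective (sval x).
Proof.
case: n x => [|n] x; last first.
  split => [nd|xI]; last by move=> /degenerateP.
  by apply: contrapT => /degenerateP.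
by split=> // _ i j _; rewrite !ord1.
Qed.

Lemma face_rng n i (y : nerve C n.+1) :
  rng y = rng (face i y) `|` [set sval y i].
Proof.
apply/seteqP; split => [_ [j _ <-]|P [[j _ <-]|->]].
- have [->|ij] := eqVneq j i; first by right.
  by left; have [k ->|jE] := unliftP i j; [exists k|rewrite jE eqxx in ij].
- by exists (lift i j).
- by exists i.
Qed.

Lemma inj_face n i (y : nerve C n.+1) : injective (sval y) ->
  injective (sval (face i y)).
Proof. by move=> yI j k /yI/lift_inj. Qed.

Lemma inj_face_notin n i (y : nerve C n.+1) : injective (sval y) ->
  ~ rng (face i y) (sval y i).
Proof. by move=> yI [j _ /yI/eqP]; rewrite eq_sym (negbTE (neq_lift _ _)). Qed.

Lemma inj_of_face n i (y : nerve C n.+1) : injective (sval (face i y)) ->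
  ~ rng (face i y) (sval y i) -> injective (sval y).
Proof.
move=> yI yi j k; have [j' ->|->] := unliftP i j;
  have [k' ->|->] := unliftP i k => //.
- by move=> /yI ->.
- by move=> E; exfalso; apply: yi; exists j'.
- by move=> E; exfalso; apply: yi; exists k'.
Qed.

Lemma rng_face n i (y : nerve C n.+1) : injective (sval y) ->
  rng (face i y) = rng y `\ sval y i.
Proof.
move=> yI; apply/seteqP; split=> P.
  move=> yP; split; first by rewrite (face_rng i y); left.
  by move=> /= Pi; apply: (inj_face_notin (i := i) yI); rewrite -Pi.
by rewrite (face_rng i y) => -[[//|->] /(_ erefl)].
Qed.

(* The index at which a member is inserted is determined by the member. *)
Lemma lift_index n i (y : nerve C n.+1) : ~ rng (face i y) (sval y i) ->
  i = #|[pred j | `[< sval (face i y) j `<=` sval y i >]]| :> nat.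
Proof.
move=> yi.
have E : [pred j | `[< sval (face i y) j `<=` sval y i >]] =i
         [pred j : 'I_n.+1 | (j < i)%N].
  move=> j; rewrite !inE; apply/asboolP/idP => [yji|ji].
    rewrite ltnNge; apply/negP => ij; apply: yi; exists j => //.
    apply/seteqP; split => //; rewrite sval_face; apply: (svalP y).2 => /=.
    by rewrite /bump ij; exact: leqW.
  by apply: (svalP y).2 => /=; rewrite /bump; lia.
by rewrite (eq_card E) card_ltn_ord // -ltnS.
Qed.

Lemma insert_uniq n (x : nerve C n) i j (y z : nerve C n.+1) :
  face i y = x -> face j z = x -> sval y i = sval z j -> ~ rng x (sval y i) ->
  i = j /\ y = z.
Proof.
move=> yx zx yz nx; have ij : i = j.
  apply: val_inj => /=; rewrite (lift_index (y := y)) ?yx // yz.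
  by rewrite [RHS](lift_index (y := z)) ?zx // -yz.
split => //; apply: nerve_simplex_inj; apply/funext => k.
rewrite -ij in yz zx; have [l ->|-> //] := unliftP i k.
by rewrite -!sval_face yx zx.
Qed.

Lemma insert_exists n (x : nerve C n) Q : C Q -> ~ rng x Q ->
  (forall P, rng x P -> P `<=` Q \/ Q `<=` P) ->
  exists (y : nerve C n.+1) i, face i y = x /\ sval y i = Q.
Proof.
(* The members below [Q] occupy an initial segment of the indices, so their number is the index at
   which [Q] goes in. *)
move=> CQ nQ tQ; pose A := [pred j | `[< sval x j `<=` Q >]].
have AE j : (j \in A) = `[< sval x j `<=` Q >] by [].
have Adown (j k : 'I_n.+1) : (j <= k)%N -> k \in A -> j \in A.
  rewrite !AE => jk /asboolP xk; apply/asboolP.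
  by apply: (subset_trans _ xk); exact: (svalP x).2.
have AP j : (j \in A) = (j < #|A|)%N.
  apply/idP/idP => [jA|].
    rewrite -(card_ltn_ord (ltn_ord j)).
    apply/subset_leq_card/fintype.subsetP => k; rewrite inE ltnS => kj.
    exact: Adown jA.
  apply: contraLR => jA; rewrite -leqNgt.
  rewrite -[leqRHS](card_ltn_ord (ltnW (ltn_ord j))).
  apply/subset_leq_card/fintype.subsetP => k kA.
  rewrite inE ltnNge; apply: contra jA => jk; exact: Adown kA.
have lti : (#|A| < n.+2)%N by rewrite ltnS -[leqRHS]card_ord max_card.
pose i := Ordinal lti.
pose y j := if unlift i j is Some k then sval x k else Q.
have yi : y i = Q by rewrite /y unlift_none.
have yl j : y (lift i j) = sval x j by rewrite /y liftK.
have yC : forall j, C (y j).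
  move=> j; have [k ->|->] := unliftP i j; last by rewrite yi.
  by rewrite yl; exact: (svalP x).1.
have ych : is_chain y.
  move=> j k; have [j' ->|->] := unliftP i j;
    have [k' ->|->] := unliftP i k => //=.
  - by rewrite !yl leq_bump2; exact: (svalP x).2.
  - rewrite yi yl /bump => jA; have : j' \in A.
      by rewrite AP; lia.
    by rewrite AE => /asboolP.
  - rewrite yi yl /bump => Ak; have : k' \notin A.
      by rewrite AP; lia.
    rewrite AE => /asboolP xk; have [|//|//] := tQ (sval x k').
    by exists k'.
  - by move=> _ ?.
exists (exist _ y (conj yC ych)), i; split => //.
by apply: nerve_simplex_inj; apply/funext => j /=; rewrite -yl.
Qed.

End quotient_cells.

Import Order.TTheory GRing.Theory Num.Theory numFieldNormedType.Exports.

(** * Topological preliminaries *)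

Section within_continuity.
Variables (T U V : topologicalType).

Lemma within_comp (f : T -> U) (g : U -> V) (A : set T) (B : set U) :
  continuous f -> (forall x, A x -> B (f x)) -> {within B, continuous g} ->
  {within A, continuous (g \o f)}.
Proof.
move=> cf AB /subspace_continuousP cg; apply/subspace_continuousP => x Ax W Wx.
have H : nbhs x [set z | B (f z) -> W (g (f z))] :=
  cf x _ (cg _ (AB _ Ax) _ Wx).
by apply: filterS H => z zW Az; apply: zW; exact: AB.
Qed.

(** Pasting along finitely many closed pieces: near [x], the pieces that do not contain [x] can be
    avoided, and the others each control [f]. *)
Lemma within_closed_cover (I : finType) (E : I -> set T) (f : T -> V)
    (D : set T) :
  (forall i, closed (E i)) -> (forall x, D x -> exists i, E i x) ->
  (forall i, {within D `&` E i, continuous f}) -> {within D, continuous f}.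
Proof.
move=> clE DE cf; apply/subspace_continuousP => x Dx W Wx.
have : \forall z \near x, forall i, D z -> E i z -> W (f z).
  apply: filter_forall => i; have [Ex|Ex] := pselect (E i x).
    have /subspace_continuousP/(_ x (conj Dx Ex) W Wx) H := cf i.
    have {}H : nbhs x [set z | (D `&` E i) z -> W (f z)] by exact: H.
    by apply: filterS H => z zW Dz Ez; exact: (zW (conj Dz Ez)).
  have H : nbhs x (~` E i).
    by apply: open_nbhs_nbhs; split => //; exact: closed_openC.
  by apply: filterS H => z nEz _ /nEz.
move=> H; suff : nbhs x [set z | D z -> W (f z)] by [].
by apply: filterS H => z zW Dz; have [i Ei] := DE _ Dz; exact: (zW i).
Qed.

Lemma within_eq (f g : T -> V) (D : set T) : (forall x, D x -> f x = g x) ->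
  {within D, continuous f} -> {within D, continuous g}.
Proof.
move=> fg; apply: subspace_eq_continuous => x; rewrite inE; exact: fg.
Qed.

End within_continuity.

Section row_continuity.
Local Open Scope ring_scope.
Variables (R : realType) (T : topologicalType).

Lemma continuous_row n (f : T -> 'rV[R]_n) :
  (forall j, continuous (fun x => f x ord0 j)) -> continuous f.
Proof.
move=> cf x W /nbhs_ballP[e e0 eW].
have : \forall z \near x, forall j, ball (f x ord0 j) e (f z ord0 j).
  by apply: filter_forall => j; apply: (cf j x); exact: nbhsx_ballx.
move=> H; suff : nbhs x [set z | W (f z)] by [].
apply: filterS H => z zW; apply: eW; split => // i j.
by rewrite ord1; exact: zW.
Qed.

Lemma continuous_bigmin (I : finType) (P : pred I) (f : I -> T -> R) :
  (forall i, continuous (f i)) ->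
  continuous (fun x => \big[Num.min/1]_(i | P i) f i x).
Proof.
move=> cf x; elim: (index_enum I) => [|i r IH].
  by under eq_fun do rewrite big_nil; exact: cvg_cst.
under eq_fun do rewrite big_cons; case: (P i) => //.
by apply: continuous_min => //; exact: cf.
Qed.

Lemma continuous_sumr (I : finType) (P : pred I) (f : I -> T -> R) :
  (forall i, continuous (f i)) -> continuous (fun x => \sum_(i | P i) f i x).
Proof.
move=> cf x; elim: (index_enum I) => [|i r IH].
  by under eq_fun do rewrite big_nil; exact: cvg_cst.
under eq_fun do rewrite big_cons; case: (P i) => //.
by apply: (@cvgD _ R^o) => //; exact: cf.
Qed.

End row_continuity.

Section monotone_maps.
Variables (m n : nat) (f : 'I_m.+1 -> 'I_n.+1).

(** An alias that remembers the monotonicity proof, so that the order morphism instance can be found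
    from it. *)
Definition monotone_map of {homo f : j k / (j <= k)%O} := f.

Variable hf : {homo f : j k / (j <= k)%O}.
HB.instance Definition _ :=
  Order.isOrderMorphism.Build _ _ _ _ (monotone_map hf) hf.

End monotone_maps.

Section realization_points.
Variables (R : realType) (X : sset).

Definition pt n (x : X n) (t : std_simplex R n) : realization R X :=
  \pi_(realization R X)%qT (existT _ (existT _ n x) t : prerealization R X).

Lemma pt_smap m n (f : {omorphism 'I_m.+1 -> 'I_n.+1}) (x : X n)
    (t : std_simplex R m) : pt (smap f x) t = pt x (push_simplex f t).
Proof.
apply/eqquotP; apply/asboolP; apply: rst_step; exact: Realization_step.
Qed.

Lemma pt_continuous n (x : X n) : continuous (@pt n x).
Proof.
move=> t; pose e (t : std_simplex R n) : prerealization R X :=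
  existT (fun s => std_simplex R (projT1 s)) (existT _ n x) t.
have ce : {for t, continuous e} by exact: existT_continuous.
exact: (continuous_comp ce (@pi_continuous _ _ (e t))).
Qed.

Lemma realization_ptP (u : realization R X) : exists n (x : X n) t, u = pt x t.
Proof.
elim/quotW: u => -[[n x] t]; by exists n, x, t.
Qed.

End realization_points.

(** * Weights on a simplex and the flow towards a vertex *)

Section weights.
Local Open Scope ring_scope.
Variables (R : realType) (a : nat).
Notation I := 'I_a.+1.
Implicit Types (w : 'rV[R]_a.+1) (B : {set I}) (i j : I).

Definition supp w : {set I} := [set i | w ord0 i != 0]%SET.

Definition weights B : set 'rV[R]_a.+1 :=
  [set w | std_simplex R a w /\ supp w \subset B].

(* The flow direction: all the coordinates in [B :\ j] decrease with unit
   speed, and the [j]-th one absorbs the loss. *)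
Definition dir B j : 'rV[R]_a.+1 :=
  \row_i (if i == j then #|(B :\ j)%SET|%:R else if i \in B then -1 else 0).

(* The default value 1 only matters when [B :\ j] is empty. *)
Definition gap B j w : R := \big[Num.min/1]_(i in (B :\ j)%SET) w ord0 i.

(** The cap at [gap B j w] stops the motion when the first coordinate in [B :\ j] vanishes. *)
Definition flow B j w (s : R) : 'rV[R]_a.+1 :=
  w + Num.min s (gap B j w) *: dir B j.

Lemma mem_supp w i : (i \in supp w) = (w ord0 i != 0).
Proof. by rewrite finset.in_set. Qed.

Lemma weights_supp B w i : weights B w -> i \notin B -> w ord0 i = 0.
Proof.
move=> [_ /fintype.subsetP wB] iB; apply/eqP/negPn; rewrite -mem_supp.
exact: contra (wB i) iB.
Qed.

Lemma weights_ge0 B w i : weights B w -> 0 <= w ord0 i.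
Proof. by case=> [[w0 _] _]. Qed.

Lemma weights_le1 B w i : weights B w -> w ord0 i <= 1.
Proof.
move=> [[w0 <-] _]; rewrite (bigD1 i) //= lerDl; exact: sumr_ge0.
Qed.

Lemma weightsS B B' w : B \subset B' -> weights B w -> weights B' w.
Proof. by move=> BB' [sw wB]; split=> //; exact: fintype.subset_trans BB'. Qed.

Lemma weights_id B w : weights B w -> weights (supp w) w.
Proof. by case. Qed.

Lemma supp_neq0 B w : weights B w -> supp w != finset.set0.
Proof.
move=> [[_ w1] _]; apply/eqP => w0; move/eqP: w1.
rewrite big1 ?(eq_sym 0) ?oner_eq0 // => i _; apply/eqP/negPn.
by rewrite -mem_supp w0 finset.in_set0.
Qed.

Lemma gap_ge0 B D j w : weights D w -> 0 <= gap B j w.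
Proof.
by move=> wD; apply/bigmin_geP; split=> // i _; exact: weights_ge0 wD.
Qed.

Lemma gap_le1 B j w : gap B j w <= 1.
Proof. exact: bigmin_le_id. Qed.

Lemma gap_le B j w i : i \in B -> i != j -> gap B j w <= w ord0 i.
Proof. by move=> iB ij; apply: bigmin_le_cond; rewrite finset.in_setD1 ij. Qed.

Lemma gap_attained B D j w i : weights D w -> i \in B -> i != j ->
  exists k, [/\ k \in B, k != j & w ord0 k = gap B j w].
Proof.
move=> wD iB ij; have iBj : i \in (B :\ j)%SET by rewrite finset.in_setD1 ij.
have [k] := @eq_bigmin _ _ _ 1 i (fun i => i \in (B :\ j)%SET)
  (fun i => w ord0 i) iBj (fun i _ => weights_le1 i wD).
by rewrite finset.in_setD1 => /andP[kj kB] kE; exists k.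
Qed.

Lemma gap_gt0 B j w : 0 < gap B j w -> (B :\ j)%SET \subset supp w.
Proof.
move=> g0; apply/fintype.subsetP => i.
rewrite finset.in_setD1 mem_supp => /andP[ij iB].
by rewrite gt_eqF // (lt_le_trans g0) // gap_le.
Qed.

Lemma gap_supp w j D : weights D w -> 0 < gap (supp w) j w.
Proof.
move=> wD; apply/bigmin_gtP; split => // i; rewrite finset.in_setD1 mem_supp.
by move=> /andP[_ wi]; rewrite lt_def wi (weights_ge0 _ wD).
Qed.

Lemma dir_sum B j : \sum_i dir B j ord0 i = 0.
Proof.
rewrite (bigD1 j) //= mxE eqxx.
rewrite (eq_bigr (fun i => if i \in (B :\ j)%SET then -1 else 0)); last first.
  by move=> i ij; rewrite mxE (negbTE ij) finset.in_setD1 ij.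
rewrite -big_mkcondr (eq_bigl (fun i => i \in (B :\ j)%SET)); last first.
  by move=> i; rewrite finset.in_setD1 /= andbA andbb.
by rewrite sumr_const mulNrn subrr.
Qed.

Lemma flowE B j w s i : flow B j w s ord0 i =
  w ord0 i + Num.min s (gap B j w) *
    (if i == j then #|(B :\ j)%SET|%:R else if i \in B then -1 else 0).
Proof. by rewrite !mxE. Qed.

Lemma flow_weights B j w s : weights B w -> 0 <= s ->
  weights (j |: B) (flow B j w s).
Proof.
move=> wB s0; have g0 : 0 <= Num.min s (gap B j w).
  by rewrite le_min s0; exact: gap_ge0 wB.
split; last first.
  apply/fintype.subsetP => i; rewrite mem_supp flowE !finset.inE.
  apply: contraNT; rewrite negb_or => /andP[/negbTE -> iB].
  by rewrite (negbTE iB) mulr0 addr0 (weights_supp wB iB).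
split=> [i|]; last first.
  rewrite /flow; under eq_bigr do rewrite mxE [X in _ + X]mxE.
  by rewrite big_split /= -mulr_sumr dir_sum mulr0 addr0; case: wB => -[].
rewrite flowE; have [->|ij] := eqVneq i j.
  by rewrite addr_ge0 ?(weights_ge0 _ wB) // mulr_ge0.
case: ifPn => iB; last by rewrite mulr0 addr0 (weights_ge0 _ wB).
by rewrite mulrN1 subr_ge0 (le_trans _ (gap_le w iB ij)) // ge_min lexx orbT.
Qed.

Lemma flow_zero B j w s k : k \in B -> k != j -> w ord0 k = gap B j w ->
  gap B j w <= s -> flow B j w s ord0 k = 0.
Proof.
move=> kB kj wk gs; rewrite flowE (negbTE kj) kB wk.
by rewrite (min_idPr gs) mulrN1 subrr.
Qed.

Lemma flow0 B j w D : weights D w -> flow B j w 0 = w.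
Proof.
move=> wD; rewrite /flow (min_idPl _) ?scale0r ?addr0 //; exact: gap_ge0 wD.
Qed.

Lemma flow_fixed j w s B : B \subset [set j]%SET -> flow B j w s = w.
Proof.
move=> Bj; apply/rowP => i; rewrite flowE; case: eqVneq => [->|ij].
  suff -> : (B :\ j)%SET = finset.set0 by rewrite cards0 mulr0 addr0.
  by apply/eqP; rewrite finset.setD_eq0.
case: ifPn; last by rewrite mulr0 addr0.
by move=> /(fintype.subsetP Bj); rewrite finset.in_set1 (negbTE ij).
Qed.

(** The coordinate attaining the gap is exhausted, while the [j]-th one has received a positive
    multiple of the positive gap. *)
Lemma flow_hit w j s i D : weights D w -> i \in supp w -> i != j ->
  gap (supp w) j w <= s ->
  let B := supp (flow (supp w) j w s) in
  [/\ B \subset j |: supp w, j \in B &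
      exists2 k, k \in (supp w :\ j)%SET & k \notin B].
Proof.
move=> wD iw ij gs /=; have ww := weights_id wD; have g0 := gap_supp j wD.
have s0 : 0 <= s by rewrite (le_trans _ gs) // ltW.
split; first by have [] := flow_weights j ww s0.
  rewrite mem_supp flowE eqxx (min_idPr gs) gt_eqF //.
  rewrite ltr_wpDl ?(weights_ge0 _ wD) // mulr_gt0 // ltr0n card_gt0.
  by apply/set0Pn; exists i; rewrite finset.in_setD1 ij.
have [k [kw kj wk]] := gap_attained ww iw ij; exists k.
  by rewrite finset.in_setD1 kj.
by rewrite mem_supp negbK (flow_zero kw kj wk gs).
Qed.

End weights.

(** With [b0] the least element of [B], an index [i] is sent to the largest element of [B] that is
    at most [maxn b0 i]. Such maps turn a chain known only on [B] into a simplex with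
    repetitions. *)
Lemma monotone_retraction n (B : {set 'I_n.+1}) : B != finset.set0 ->
  exists f : 'I_n.+1 -> 'I_n.+1, [/\ {homo f : j k / (j <= k)%O},
    forall i, f i \in B & forall i, i \in B -> f i = i].
Proof.
move=> /set0Pn[i0 i0B].
have [b0 b0B b0min] := @arg_minnP _ i0 (fun i => i \in B) val i0B.
have /choice[f fP] (i : 'I_n.+1) : exists b, [/\ b \in B, (b <= maxn b0 i)%N &
    forall b', b' \in B -> (b' <= maxn b0 i)%N -> (b' <= b)%N].
  have b0P : (b0 \in B) && (b0 <= maxn b0 i)%N by rewrite b0B leq_maxl.
  have [b /andP[bB bi] bmax] :=
    @arg_maxnP _ b0 (fun b => (b \in B) && (b <= maxn b0 i)%N) val b0P.
  by exists b; split => // b' b'B b'i; apply: bmax; rewrite b'B.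
exists f; split => [j k jk|i|i iB]; last 1 first.
- have [fB fi fmax] := fP i; apply/val_inj/eqP; rewrite eqn_leq.
  rewrite fmax ?leq_maxr // andbT; apply: leq_trans fi _.
  by rewrite geq_max leqnn andbT; exact: b0min.
- have [fB fi _] := fP j; have [_ _ fmax] := fP k.
  rewrite leEord in jk *; apply: fmax => //.
  by apply: leq_trans fi _; rewrite geq_max leq_maxl leq_max jk orbT.
- by have [] := fP i.
Qed.

(** * Chains in the collection: tops, apexes, insertion and removal *)

Section collection.
Variables (G : groupType) (p : nat) (C : set (set G)) (S : set G).
Hypotheses (p_prime : prime p) (Gfin : pseudo_finite_at G p).
Hypotheses (CSp : C `<=` Sp G p) (Cconj : conj_closed C).
Hypotheses (Cover : overgroup_closed p C) (Ssyl : sylow p setT S).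
Hypothesis C0 : C !=set0.
Implicit Types (P Q K L T N : set G) (Z W : set (set G)) (g : G).

Notation lg := (lg p).

Definition chain_set Z : Prop :=
  [/\ Z !=set0, Z `<=` C &
      forall P Q, Z P -> Z Q -> P `<=` Q \/ Q `<=` P].

Lemma C_fin P : C P -> fin_p_subgroup p P.
Proof. by case/CSp. Qed.

Lemma C_lg P : C P -> (lg P <= lg S)%N.
Proof.
move=> /C_fin Pp; have [Sp _ /(_ _ Pp)[//|g _ PS]] := Ssyl.
by rewrite -(lg_conj p P g); apply: fin_p_lg_le => //; exact: fin_p_conj.
Qed.

Lemma C_over P Q : C P -> fin_p_subgroup p Q -> P `<=` Q -> C Q.
Proof.
move=> CP Qp PQ; apply: (Cover CP) => //; split=> // Q1.
have [Pp] := CSp CP; apply; apply/seteqP; split; first by rewrite -Q1.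
by move=> _ ->; exact: (subgroup1 Pp.1).
Qed.

Lemma chain_lg Z P Q : chain_set Z -> Z P -> Z Q ->
  P `<=` Q <-> (lg P <= lg Q)%N.
Proof.
move=> [_ ZC Zt] ZP ZQ.
have [Pp Qp] : fin_p_subgroup p P /\ fin_p_subgroup p Q.
  by split; exact/C_fin/ZC.
split; first exact: fin_p_lg_le.
by have [//|QP] := Zt _ _ ZP ZQ; move/(fin_p_lg_eq p_prime Qp Pp QP) ->.
Qed.

(** Exponents of members are bounded by [lg S], so some member of [W] has largest order; in a chain
    it contains the others. *)
Lemma chain_max Z W : chain_set Z -> W `<=` Z -> W !=set0 ->
  exists2 P, W P & forall Q, W Q -> Q `<=` P.
Proof.
move=> Zch WZ [P0 WP0].
pose E n := `[< exists2 P, W P & lg P = n >].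
have exE : exists n, E n by exists (lg P0); apply/asboolP; exists P0.
have [//|n /asboolP[P WP <-] Pmax] := @ex_maxnP E (lg S) exE.
  move=> n /asboolP[P /WZ ZP <-]; apply: C_lg.
  by case: Zch => _ + _; exact.
exists P => // Q WQ; apply/(chain_lg Zch (WZ _ WQ) (WZ _ WP)).
by apply: Pmax; apply/asboolP; exists Q.
Qed.

Lemma chain_min Z W : chain_set Z -> W `<=` Z -> W !=set0 ->
  exists2 P, W P & forall Q, W Q -> P `<=` Q.
Proof.
move=> Zch WZ [P0 WP0].
pose E n := `[< exists2 P, W P & lg P = n >].
have exE : exists n, E n by exists (lg P0); apply/asboolP; exists P0.
have [n /asboolP[P WP <-] Pmin] := @ex_minnP E exE.
exists P => // Q WQ; apply/(chain_lg Zch (WZ _ WP) (WZ _ WQ)).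
by apply: Pmin; apply/asboolP; exists Q.
Qed.

(** Pseudo finiteness speaks of indexed chains. The entry at [e] is the largest member with exponent
    at most [e]; the maximum with the exponent of the least member [P0] keeps the choice possible
    for small [e]. Each member then occurs at its own exponent. *)
Lemma chain_enum Z : chain_set Z ->
  exists x : 'I_(lg S).+1 -> set G, is_chain x /\ range x = Z.
Proof.
move=> Zch; have [Zn0 ZC Zt] := Zch.
have [P0 ZP0 P0min] := chain_min Zch (@subset_refl _ _) Zn0.
pose W (e : nat) := [set P | Z P /\ (lg P <= maxn (lg P0) e)%N].
have WZ e : W e `<=` Z by move=> P [].
have W0 e : W e P0 by split => //; exact: leq_maxl.
have /choice[x xP] (e : 'I_(lg S).+1) :
    exists P, W e P /\ forall Q, W e Q -> Q `<=` P.
  have [|P WP Pmax] := chain_max Zch (@WZ e); first by exists P0.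
  by exists P.
exists x; split.
  move=> i j ij; apply: (xP j).2; have [[ZP lgP] _] := xP i.
  split => //; apply: leq_trans lgP _.
  by rewrite geq_max leq_maxl leq_max ij orbT.
apply/seteqP; split => [_ [e _ <-]|P ZP]; first by have [[]] := xP e.
have eP : (lg P < (lg S).+1)%N by rewrite ltnS; exact/C_lg/ZC.
exists (Ordinal eP) => //; have [[Zx /= lgx] mx] := xP (Ordinal eP).
apply/seteqP; split.
  apply/(chain_lg Zch) => //; rewrite (maxn_idPr _) // in lgx.
  by apply/(chain_lg Zch) => //; exact: P0min.
by apply: mx; split => //=; exact: leq_maxr.
Qed.

Lemma top_exists Z : chain_set Z -> exists K, is_top Z K.
Proof.
move=> Zch; have [Zn0 ZC Zt] := Zch.
have [P0 ZP0 P0min] := chain_min Zch (@subset_refl _ _) Zn0.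
have [||K [ZK nK] mK] :=
  chain_max (W := [set K | Z K /\ prefix_normal Z K]) Zch.
- by move=> ? [].
- exists P0; split=> // P ZP PP0; have -> : P = P0.
    by apply/seteqP; split => //; exact: P0min.
  by move=> x P0x; apply: conj_set_id => //; exact: (C_fin (ZC _ ZP0)).1.
by exists K; split=> // P ZP nP; exact: mK.
Qed.

Lemma subgroup_stab Z K : Z `<=` C -> subgroup (stab Z K).
Proof.
move=> ZC; split.
  apply/mem_set; split=> [P ZP _|L ZL _]; first exact: conj_set1.
  exact: (subgroup1 (C_fin (ZC _ ZL)).1).
move=> x y /set_mem[xN xL] /set_mem[yN yL]; apply/mem_set; split.
  move=> P ZP PK; have NG := subgroup_normalizer P.
  by apply: (subgroupM NG); [exact: xN|apply: (subgroupV NG); exact: yN].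
move=> L ZL LK; have LG := (C_fin (ZC _ ZL)).1.
by apply: (subgroupM LG); [exact: xL|apply: (subgroupV LG); exact: yL].
Qed.

Lemma stab_fix Z K g P : Z `<=` C -> stab Z K g -> Z P -> conj_set P g = P.
Proof.
move=> ZC [gN gL] ZP; have [PK|PK] := pselect (P `<=` K); first exact: gN.
by apply: conj_set_id; [exact: (C_fin (ZC _ ZP)).1|exact: gL].
Qed.

Lemma top_stab Z K : chain_set Z -> is_top Z K -> K `<=` stab Z K.
Proof.
move=> [_ ZC Zt] [ZK nK _] x Kx; split => [P ZP PK|L ZL LK]; first exact: nK.
by have [//|] := Zt _ _ ZL ZK; exact.
Qed.

Lemma next_above Z K L : chain_set Z -> Z L -> ~ L `<=` K ->
  exists L0, [/\ Z L0, ~ L0 `<=` K &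
    forall L', Z L' -> ~ L' `<=` K -> L0 `<=` L'].
Proof.
move=> Zch ZL LK.
have [||L0 [ZL0 L0K] mL0] := chain_min (W := [set L | Z L /\ ~ L `<=` K]) Zch.
- by move=> ? [].
- by exists L.
by exists L0; split=> // L' ZL' L'K; exact: mL0.
Qed.

(** If some member [L] is not below [K], then [stab Z K] is a subgroup of [L], hence a finite
    p-group and its own Sylow subgroup. Otherwise it is the normalizer of the whole chain, and
    pseudo finiteness applies. *)
Lemma sylow_stab_exists Z K : chain_set Z -> exists Q, sylow p (stab Z K) Q.
Proof.
move=> Zch; have [Zn0 ZC Zt] := Zch.
have [[L [ZL LK]]|noL] := pselect (exists L, Z L /\ ~ L `<=` K).
  exists (stab Z K); apply: sylow_refl.
  apply: (fin_p_sub p_prime (C_fin (ZC _ ZL))).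
    exact: subgroup_stab.
  by move=> g [_]; exact.
have [x [xch xZ]] := chain_enum Zch.
have [|Q Qs] := Gfin _ xch.
  by move=> i; apply/C_fin/ZC; rewrite -xZ; exists i.
exists Q; suff -> : stab Z K = chain_normalizer x by [].
apply/seteqP; split => [g [gN _] i _|g gx].
  have Zx : Z (x i) by rewrite -xZ; exists i.
  by apply: gN => //; apply: contrapT => xK; apply: noL; exists (x i).
split=> [P|L ZL LK]; last by exfalso; apply: noL; exists L.
by rewrite -xZ => -[i _ <-] _; exact: gx.
Qed.

(** Being a p-subgroup of [stab Z K], [K] is conjugate into [Q] by an element of that group, and
    such elements fix [K]. *)
Lemma top_sub_sylow Z K Q : chain_set Z -> is_top Z K ->
  sylow p (stab Z K) Q -> K `<=` Q.
Proof.
move=> Zch Ktop [_ _ QS]; have [_ ZC _] := Zch; have [ZK _ _] := Ktop.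
have [|g gK] := QS K (C_fin (ZC _ ZK)); first exact: top_stab.
by rewrite (stab_fix ZC gK ZK).
Qed.

Section insert.
Variables (Z : set (set G)) (K Q : set G).
Hypotheses (Zch : chain_set Z) (Ktop : is_top Z K).
Hypotheses (Qsyl : sylow p (stab Z K) Q).

Let KQ : K `<=` Q. Proof. exact: top_sub_sylow Qsyl. Qed.

Lemma insert_CQ : C Q.
Proof.
have [_ ZC _] := Zch; have [ZK _ _] := Ktop; have [Qp _ _] := Qsyl.
exact: (C_over (ZC _ ZK)).
Qed.

Lemma insert_chain : chain_set (Z `|` [set Q]).
Proof.
have [Zn0 ZC Zt] := Zch; have [ZK _ _] := Ktop; have [Qp QM _] := Qsyl.
have PQ P : Z P -> P `<=` Q \/ Q `<=` P.
  move=> ZP; have [PK|PK] := pselect (P `<=` K).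
    by left; exact: subset_trans PK KQ.
  by right=> x /QM[_]; exact.
split.
- by exists K; left.
- by move=> P [/ZC//|->]; exact: insert_CQ.
- move=> P R [ZP|->] [ZR|->]; [exact: Zt|exact: PQ| |by left].
  by have [] := PQ _ ZR; [right|left].
Qed.

(** A member not below [K] contains [Q], so the members below [Q] are [Q] itself and those below
    [K], which [Q] normalizes. A rival in [Z] is already a candidate for the top of [Z], hence lies
    in [K]. *)
Lemma insert_top : is_top (Z `|` [set Q]) Q.
Proof.
have [Zn0 ZC Zt] := Zch; have [ZK nK mK] := Ktop; have [Qp QM _] := Qsyl.
have nQQ : Q `<=` normalizer Q by move=> x; exact: conj_set_id Qp.1.
split; first by right.
- move=> P [ZP PQ|->//]; have [PK|PK] := pselect (P `<=` K).
    by move=> x /QM[xN _]; exact: xN.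
  have QP : Q `<=` P by move=> x /QM[_]; exact.
  by have -> : P = Q by apply/seteqP; split.
- move=> P [ZP nP|-> _ //]; apply: (subset_trans _ KQ); apply: mK => //.
  by move=> R ZR; apply: nP; left.
Qed.

Hypothesis QK : Q <> K.

Lemma insert_notin : ~ Z Q.
Proof.
move=> ZQ; have [_ nQ _] := insert_top; have [ZK nK mK] := Ktop.
apply: QK; apply/seteqP; split => //; apply: mK => // P ZP.
by move=> PQ; apply: nQ => //; left.
Qed.

(** The members below [K] are below [Q], and those not below [K] contain [Q] strictly because [Q] is
    new; so the conditions on the right are among those on the left. *)
Lemma insert_stab : stab (Z `|` [set Q]) Q `<=` stab Z K.
Proof.
move=> g [gN gL]; split => [P ZP PK|L ZL LK].
  by apply: gN; [left|exact: subset_trans PK KQ].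
apply: gL; first by left.
have [_ QM _] := Qsyl; have QL : Q `<=` L by move=> x /QM[_]; exact.
by move=> LQ; apply: insert_notin; have <- : L = Q by apply/seteqP; split.
Qed.

(** A Sylow subgroup of the smaller group contains [Q], which is already maximal among the
    p-subgroups of the larger one. *)
Lemma insert_sylow : sylow p (stab (Z `|` [set Q]) Q) Q.
Proof.
have [T Ts] := sylow_stab_exists Q insert_chain.
have QT := top_sub_sylow insert_chain insert_top Ts.
have [Tp TM _] := Ts; suff TQ : T = Q by rewrite TQ in Ts.
by apply: (sylow_max p_prime Qsyl) => //; exact: (subset_trans TM insert_stab).
Qed.

End insert.

Section remove.
Variables (Z : set (set G)) (K : set G).
Hypotheses (Zch : chain_set Z) (Ktop : is_top Z K).
Hypotheses (Ksyl : sylow p (stab Z K) K) (ZneK : Z <> [set K]).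

(* Otherwise the normalizer of [K] in [T] would be a larger [p]-subgroup of
   [stab Z K]. *)
Lemma no_growth T : fin_p_subgroup p T -> K `<=` T ->
  (forall P, Z P -> P `<=` K -> P <> K -> T `<=` normalizer P) ->
  (forall L, Z L -> ~ L `<=` K -> T `<=` L) -> T = K.
Proof.
move=> Tp KT TN TL; apply: contrapT => TK; have [Kp _ _] := Ksyl.
have [|x TNx Kx] := fin_p_normalizer_grows p_prime Tp Kp.1 KT.
  exact: nesym.
apply: Kx; suff <- : T `&` normalizer K = K by [].
have TNG : subgroup (T `&` normalizer K).
  by apply: subgroupI; [exact: Tp.1|exact: subgroup_normalizer].
apply: (sylow_max p_prime Ksyl).
- by apply: (fin_p_sub p_prime Tp) => // ? [].
- move=> y [Ty Ny]; split => [P ZP PK|L ZL LK]; last exact: TL.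
  by have [->//|/(TN _ ZP PK)] := pselect (P = K); exact.
- by move=> y Ky; split; [exact: KT|exact: conj_set_id Kp.1 Ky].
Qed.

Let Z0 := Z `\ K.

Lemma remove_top : exists K0, [/\ is_top Z0 K0, K0 `<=` K, K0 <> K &
  forall P, Z0 P -> P `<=` K -> P `<=` K0].
Proof.
have [Zn0 ZC Zt] := Zch; have [ZK nK mK] := Ktop; have [Kp _ _] := Ksyl.
pose W := [set P | Z0 P /\ P `<=` K].
have WZ : W `<=` Z by move=> P [[]].
have above L : Z L -> ~ L `<=` K -> K `<=` L.
  by move=> ZL LK; have [//|] := Zt _ _ ZK ZL.
(* If no member were strictly below [K], the next member [L0] above [K] would satisfy the hypotheses
   of [no_growth], the first vacuously and the second by minimality, and would equal [K]. *)
have [K0 [[ZK0 K0K] sK0K] K0max] : exists2 P, W P & forall Q, W Q -> Q `<=` P.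
  apply: (chain_max Zch WZ); apply: contrapT => W0.
  have [L [ZL LK]] : exists L, Z L /\ L <> K.
    apply: contrapT => noL; apply: ZneK; apply/seteqP; split => [P ZP|_ ->//].
    by apply: contrapT => PK; apply: noL; exists P.
  have nLK : ~ L `<=` K by move=> sLK; apply: W0; exists L.
  have [L0 [ZL0 L0K L0min]] := next_above Zch ZL nLK.
  apply: (L0K); rewrite (@no_growth L0) //; [exact/C_fin/ZC|exact: above|].
  by move=> P ZP PK PneK; exfalso; apply: W0; exists P.
exists K0; split => //; last by move=> P Z0P PK; exact: K0max.
split => //.
  move=> P [ZP PK] PK0 x /sK0K; apply: nK => //.
  exact: subset_trans PK0 sK0K.
(* A rival [P] not below [K0] would contain [K]. The next member [L0] above [K] lies in [P], so it
   normalizes the members strictly below [K], and [no_growth] forces [L0 = K]. *)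
move=> P [ZP PK] nP; apply: contrapT => PK0.
have nPK : ~ P `<=` K by move=> sPK; apply: PK0; exact: K0max.
have [L0 [ZL0 L0K L0min]] := next_above Zch ZP nPK.
apply: (L0K); rewrite (@no_growth L0) //; [exact/C_fin/ZC|exact: above|].
move=> R ZR RK RneK; apply: subset_trans (nP _ _ _); first exact: L0min.
- by split.
- by apply: subset_trans RK _; exact: above.
Qed.

Lemma remove_chain : chain_set Z0.
Proof.
have [Zn0 ZC Zt] := Zch; have [K0 [[Z0K0 _ _] _ _ _]] := remove_top.
split; [by exists K0|by move=> P [/ZC]|by move=> P Q [ZP _] [ZQ _]; exact: Zt].
Qed.

(** [K] normalizes the members below it and lies in the others, so it is a p-subgroup of the new
    group. A Sylow subgroup of that group, conjugated so as to contain [K], meets the hypotheses of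
    [no_growth] and hence equals [K]. *)
Lemma remove_sylow K0 : is_top Z0 K0 -> sylow p (stab Z0 K0) K.
Proof.
have [K1 [K1top K1K K1neK K1max]] := remove_top.
move=> /(is_top_uniq K1top) <- {K0}.
have [Zn0 ZC Zt] := Zch; have [ZK nK mK] := Ktop; have [Kp _ _] := Ksyl.
have K1above L : Z0 L -> ~ L `<=` K1 -> ~ L `<=` K.
  by move=> ZL LK1 LK; apply: LK1; exact: K1max.
have KM : K `<=` stab Z0 K1.
  move=> x Kx; split => [P [ZP PK] PK1|L Z0L /(K1above _ Z0L) LK].
    by apply: (nK _ ZP) => //; exact: subset_trans PK1 K1K.
  by have [ZL _] := Z0L; have [/LK|] := Zt _ _ ZL ZK; last exact.
have MG : subgroup (stab Z0 K1) by apply: subgroup_stab => P [/ZC].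
have [T Ts] := sylow_stab_exists K1 remove_chain.
have [_ _ /(_ K Kp KM)[g Mg KT]] := Ts.
have {Ts}Ts := sylow_conj_in MG (subgroupV MG Mg) Ts.
move/conj_setSV: KT => KT.
suff TK : conj_set T g^-1 = K by rewrite TK in Ts.
have [Tp TM _] := Ts; apply: no_growth => //.
- move=> P ZP PK PneK x /TM[xN _]; apply: xN => //.
  exact: K1max.
- move=> L ZL LK x /TM[_ xL]; apply: xL.
    by split => // LeK; apply: LK; rewrite LeK.
  by move=> LK1; apply: LK; exact: subset_trans LK1 K1K.
Qed.

End remove.

(** A conjugate of [S] contains [K], and for a chain with one member the last two hypotheses of
    [no_growth] are vacuous. *)
Lemma critical_sylow K : C K -> sylow p (stab [set K] K) K ->
  exists g, conj_set K g = S.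
Proof.
move=> CK Ks; have [Sp _ SS] := Ssyl; have Kp := C_fin CK.
have [//|g _ KS] := SS K Kp.
have Kch : chain_set [set K].
  by split; [exists K|move=> _ ->|move=> _ _ -> ->; left].
have Ktop : is_top [set K] K.
  split => //; last by move=> _ -> _.
  by move=> _ -> _ x; exact: conj_set_id Kp.1.
exists g; suff <- : conj_set S g^-1 = K by rewrite conj_setVK.
apply: (no_growth Ks).
- exact: fin_p_conj.
- exact/conj_setSV.
- by move=> _ -> _ /(_ erefl).
- by move=> _ -> /(_ (fun=> id)).
Qed.

Lemma sylow_critical Q : sylow p setT Q -> C Q -> sylow p (stab [set Q] Q) Q.
Proof.
move=> Qs CQ; have [Qp _ _] := Qs.
have Qch : chain_set [set Q].
  by split; [exists Q|move=> _ ->|move=> _ _ -> ->; left].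
have Qtop : is_top [set Q] Q.
  split => //; last by move=> _ -> _.
  by move=> _ -> _ x; exact: conj_set_id Qp.1.
have [T Ts] := sylow_stab_exists Q Qch; have [Tp _ _] := Ts.
suff TQ : T = Q by rewrite TQ in Ts.
by apply: (sylow_max p_prime Qs Tp) => //; exact: (top_sub_sylow Qch).
Qed.

Definition apex Z Q : Prop := exists2 K, is_top Z K & sylow p (stab Z K) Q.

Definition height Z : nat := lg (xget set0 [set K | is_top Z K]).

Lemma heightE Z K : is_top Z K -> height Z = lg K.
Proof.
move=> Ktop; rewrite /height; congr lg.
exact: is_top_uniq (xgetPex set0 (ex_intro _ K Ktop)) Ktop.
Qed.

Lemma apex_exists Z : chain_set Z -> exists Q, apex Z Q.
Proof.
move=> Zch; have [K Ktop] := top_exists Zch.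
by have [Q Qs] := sylow_stab_exists K Zch; exists Q, K.
Qed.

Lemma apex_conj Z Q g : apex Z Q -> apex (conjs Z g) (conj_set Q g).
Proof.
case=> K Ktop Qs; exists (conj_set K g); first exact: is_top_conj.
by rewrite stab_conj; exact: sylow_conj.
Qed.

Lemma apex_uniq Z Q Q' : chain_set Z -> apex Z Q -> apex Z Q' ->
  exists2 g, (forall P, Z P -> conj_set P g = P) & conj_set Q g = Q'.
Proof.
move=> Zch [K Ktop Qs] [K' /(is_top_uniq Ktop) <-] Qs'.
have [_ ZC _] := Zch.
have [g Mg gQ] := sylow_uniq p_prime (subgroup_stab K ZC) Qs Qs'.
by exists g => // P; exact: (stab_fix ZC Mg).
Qed.

Lemma apex_mem_top Z K Q : chain_set Z -> is_top Z K ->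
  sylow p (stab Z K) Q -> Z Q -> Q = K.
Proof.
move=> Zch Ktop Qs ZQ; apply: contrapT => QK.
exact: (insert_notin Zch Ktop Qs QK).
Qed.

Lemma apex_C Z Q : chain_set Z -> apex Z Q -> C Q.
Proof. by move=> Zch [K Ktop Qs]; exact: (insert_CQ Zch Ktop Qs). Qed.

Lemma apex_insert_chain Z Q : chain_set Z -> apex Z Q ->
  chain_set (Z `|` [set Q]).
Proof. by move=> Zch [K Ktop Qs]; exact: (insert_chain Zch Ktop Qs). Qed.

Lemma apex_insert Z Q : chain_set Z -> apex Z Q -> apex (Z `|` [set Q]) Q.
Proof.
move=> Zch [K Ktop Qs]; have [ZQ|ZQ] := pselect (Z Q).
  have -> : Z `|` [set Q] = Z by apply/setUidl => _ ->.
  by exists K.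
have QK : Q <> K by move=> QK; apply: ZQ; rewrite QK; case: Ktop.
exists Q; first exact: (insert_top Zch Ktop Qs).
exact: (insert_sylow Zch Ktop Qs QK).
Qed.

Lemma apex_remove Z Q : chain_set Z -> apex Z Q -> Z Q ->
  Z <> [set Q] -> apex (Z `\ Q) Q.
Proof.
move=> Zch [K Ktop Qs] ZQ.
have QK := apex_mem_top Zch Ktop Qs ZQ; rewrite QK in Qs *.
move=> ZneK; have [K0 [K0top _ _ _]] := remove_top Zch Ktop Qs ZneK.
by exists K0 => //; exact: (remove_sylow Zch Ktop Qs ZneK).
Qed.

Lemma height_le Z : chain_set Z -> (height Z <= lg S)%N.
Proof.
move=> Zch; have [K Ktop] := top_exists Zch; rewrite (heightE Ktop).
by case: Zch => _ ZC _; case: Ktop => ZK _ _; exact/C_lg/ZC.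
Qed.

Lemma height_conj Z g : chain_set Z -> height (conjs Z g) = height Z.
Proof.
move=> Zch; have [K Ktop] := top_exists Zch.
by rewrite (heightE Ktop) (heightE (is_top_conj g Ktop)) lg_conj.
Qed.

Lemma height_insert Z Q : chain_set Z -> apex Z Q -> ~ Z Q ->
  (height Z < height (Z `|` [set Q]))%N.
Proof.
move=> Zch [K Ktop Qs] ZQ.
have QK : Q <> K by move=> QK; apply: ZQ; rewrite QK; case: Ktop.
rewrite (heightE Ktop) (heightE (insert_top Zch Ktop Qs)).
have KQ := top_sub_sylow Zch Ktop Qs; have [Qp _ _] := Qs.
have Kp : fin_p_subgroup p K.
  by case: Zch => _ ZC _; case: Ktop => ZK _ _; exact/C_fin/ZC.
by rewrite ltnNge; apply/negP => /(fin_p_lg_eq p_prime Kp Qp KQ); exact/nesym.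
Qed.

(** An apex that belongs to [Z] is its top. It still normalizes the members below it in the subchain
    [W], so the top of [W] contains it. *)
Lemma height_sub Z W Q : chain_set Z -> chain_set W -> apex Z Q -> Z Q ->
  W `<=` Z -> W Q -> (height Z <= height W)%N.
Proof.
move=> Zch Wch [K Ktop Qs] ZQ; rewrite (apex_mem_top Zch Ktop Qs ZQ) => WZ WK.
have [K' K'top] := top_exists Wch.
have KK' := is_top_sub Ktop WZ WK K'top.
rewrite (heightE Ktop) (heightE K'top); apply: fin_p_lg_le => //.
- by case: Zch => _ ZC _; case: Ktop => ZK _ _; exact/C_fin/ZC.
- by case: Wch => _ WC _; case: K'top => WK' _ _; exact/C_fin/WC.
Qed.

Lemma apex_set1 Q : C Q -> apex [set Q] Q -> exists g, conj_set Q g = S.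
Proof.
move=> CQ [K [-> _ _] Qs]; exact: (critical_sylow CQ).
Qed.

Lemma C_sylow : C S.
Proof.
have [P CP] := C0; have [Sp _ /(_ _ (C_fin CP))[//|g _ PS]] := Ssyl.
exact: (C_over (Cconj g CP)).
Qed.

Lemma apex_sylow : apex [set S] S.
Proof.
exists S; last exact: (sylow_critical Ssyl C_sylow).
have [Sp _ _] := Ssyl; split=> [//|_ -> _ x|_ -> _ //].
exact: conj_set_id Sp.1.
Qed.

(** * The matching *)

Definition red_chain Z : Prop := exists2 Q, apex Z Q & ~ Z Q.

Definition coll_chain Z : Prop := exists2 Q, apex Z Q & Z Q /\ Z <> [set Q].

Definition crit_chain Z : Prop := exists2 Q, apex Z Q & Z = [set Q].

(** The conjugation between the two apexes fixes all members of [Z], hence [Q]. So the type of a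
    chain does not depend on the apex chosen. *)
Lemma apex_mem Z Q Q' : chain_set Z -> apex Z Q -> apex Z Q' -> Z Q -> Q' = Q.
Proof.
by move=> Zch aQ aQ' ZQ; have [g gZ <-] := apex_uniq Zch aQ aQ'; exact: gZ.
Qed.

Lemma chain_cases Z : chain_set Z ->
  crit_chain Z \/ red_chain Z \/ coll_chain Z.
Proof.
move=> Zch; have [Q aQ] := apex_exists Zch.
have [ZQ|ZQ] := pselect (Z Q); last by right; left; exists Q.
have [Z1|Z1] := pselect (Z = [set Q]); first by left; exists Q.
by right; right; exists Q.
Qed.

Lemma chain_disjoint Z : chain_set Z ->
  [/\ crit_chain Z -> red_chain Z -> False,
      crit_chain Z -> coll_chain Z -> False &
      red_chain Z -> coll_chain Z -> False].
Proof.
move=> Zch; split.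
- move=> [Q aQ ZE] [Q' aQ']; apply; have ZQ : Z Q by rewrite ZE.
  by rewrite (apex_mem Zch aQ aQ' ZQ).
- move=> [Q aQ ZE] [Q' aQ' [_]]; apply; have ZQ : Z Q by rewrite ZE.
  by rewrite (apex_mem Zch aQ aQ' ZQ).
- move=> [Q aQ ZQ] [Q' aQ' [ZQ' _]]; apply: ZQ.
  by rewrite (apex_mem Zch aQ' aQ ZQ').
Qed.

Lemma conjs_set1 Q g : conjs [set Q] g = [set conj_set Q g].
Proof. exact: image_set1. Qed.

Lemma red_chain_conj Z g : red_chain Z -> red_chain (conjs Z g).
Proof.
case=> Q aQ ZQ; exists (conj_set Q g); first exact: apex_conj.
by move/conjs_conj.
Qed.

Lemma coll_chain_conj Z g : coll_chain Z -> coll_chain (conjs Z g).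
Proof.
case=> Q aQ [ZQ Z1]; exists (conj_set Q g); first exact: apex_conj.
split; first exact/conjs_conj.
by rewrite -conjs_set1 => /(congr1 (fun W => conjs W g^-1)); rewrite !conjsK.
Qed.

Notation X := (nerve_quotient Cconj).
Notation class := (class Cconj).

Definition kind (T : set (set G) -> Prop) n : set (X n) :=
  [set O | exists x : nerve C n,
    [/\ O = class x, injective (sval x) & T (rng x)]].

Lemma kind_class (T : set (set G) -> Prop) n (x : nerve C n) :
  (forall Z g, T Z -> T (conjs Z g)) ->
  kind T (class x) <-> injective (sval x) /\ T (rng x).
Proof.
move=> Tc; split; last by case=> xI Tx; exists x.
move=> [y [/esym/class_eq[g ->] yI Ty]].
by split; [exact: inj_conj|rewrite rng_conj; exact: Tc].
Qed.

Lemma rng_chain n (x : nerve C n) : chain_set (rng x).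
Proof.
split; first by exists (sval x ord0); exists ord0.
  by move=> _ [i _ <-]; exact: (svalP x).1.
move=> _ _ [i _ <-] [j _ <-]; have [ij|ji] := leqP i j.
  by left; exact: (svalP x).2.
by right; apply: (svalP x).2; exact: ltnW.
Qed.

Definition apex_at n (O : X n.+1) (i : 'I_n.+2) : Prop :=
  exists y, [/\ O = class y, injective (sval y) & apex (rng y) (sval y i)].

Lemma rng_not1 n (y : nerve C n.+1) Q : injective (sval y) -> rng y <> [set Q].
Proof.
move=> yI y1; have E i : sval y i = Q.
  by have : rng y (sval y i); [exists i|rewrite y1].
have /yI/(congr1 val) : sval y ord0 = sval y ord_max by rewrite !E.
by [].
Qed.

Lemma coll_apex_at n (O : X n.+1) : kind coll_chain O <-> exists i, apex_at O i.
Proof.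
split=> [[y [-> yI [Q aQ [[i _ iQ] _]]]]|[i [y [-> yI ay]]]].
  by exists i, y; split => //; rewrite iQ.
apply/kind_class; first exact: coll_chain_conj.
by split=> //; exists (sval y i) => //; split; [exists i|exact: rng_not1].
Qed.

(** Allows two cofaces of one orbit to be compared over the same chain [x], not merely over
    conjugate chains. *)
Lemma apex_at_rep n (O : X n.+1) i (x : nerve C n) :
  apex_at O i -> face i O = class x ->
  exists y, [/\ O = class y, injective (sval y), apex (rng y) (sval y i) &
    face i y = x].
Proof.
move=> [y [-> yI ay]]; rewrite face_class => /class_eq[g ->].
exists (nerve_conj Cconj y g); split.
- by rewrite class_conj.
- exact: inj_conj.
- by rewrite rng_conj; exact: apex_conj.
- exact: nerve_simplex_inj.
Qed.

Lemma apex_face n i (y : nerve C n.+1) : injective (sval y) ->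
  apex (rng y) (sval y i) ->
  apex (rng (face i y)) (sval y i) /\ ~ rng (face i y) (sval y i).
Proof.
move=> yI ay; split; last exact: inj_face_notin.
rewrite (rng_face _ yI); apply: apex_remove => //; first exact: rng_chain.
- by exists i.
- exact: rng_not1.
Qed.

Lemma red_face n (O : X n.+1) i : apex_at O i -> kind red_chain (face i O).
Proof.
move=> [y [-> yI ay]]; rewrite face_class; have [aF nF] := apex_face yI ay.
apply/kind_class; first exact: red_chain_conj.
by split; [exact: inj_face|exists (sval y i)].
Qed.

Lemma apex_at_uniq n (O : X n.+1) i j : apex_at O i -> apex_at O j -> i = j.
Proof.
move=> [y [-> yI ay]] [z [/class_eq[g ->] zI]].
rewrite rng_conj => /(@apex_conj _ _ g^-1); rewrite conjsK conj_setK => aj.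
by apply/esym/yI/(apex_mem (rng_chain y) ay aj); exists i.
Qed.

Lemma red_mate n (O : X n) : kind red_chain O ->
  exists (U : X n.+1) i, apex_at U i /\ face i U = O.
Proof.
move=> [x [-> xI [Q aQ xQ]]].
have xch := rng_chain x.
have [|//||y [i [yx yi]]] := @insert_exists _ _ _ x Q.
- exact: apex_C aQ.
- have [_ _ tQ] := apex_insert_chain xch aQ; move=> P xP.
  by apply: tQ; [left|right].
exists (class y), i; rewrite face_class yx; split => //.
exists y; split=> //; first by apply: (inj_of_face (i := i)); rewrite yx // yi.
by rewrite (face_rng i y) yx yi; exact: apex_insert.
Qed.

(** Over a common face [x], both inserted members are apexes of [x], hence conjugate by an element
    fixing [x]; the place of insertion is then forced. *)
Lemma mate_uniq n (O : X n) (U V : X n.+1) i j :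
  apex_at U i -> apex_at V j -> face i U = O -> face j V = O -> U = V.
Proof.
have [x ->] := classP O; move=> Ui Vj.
move=> /(apex_at_rep Ui)[y [-> yI ay yx]] /(apex_at_rep Vj)[z [-> zI az zx]].
have [ay' ny] := apex_face yI ay; have [az' nz] := apex_face zI az.
rewrite yx in ay' ny; rewrite zx in az' nz.
have [g gx yz] := apex_uniq (rng_chain x) ay' az'.
rewrite -(class_conj Cconj y g).
have yx' : face i (nerve_conj Cconj y g) = x.
  apply: nerve_simplex_inj; apply/funext => k.
  rewrite sval_face /= -[RHS](gx (sval x k)); last by exists k.
  by rewrite -yx.
by have [|_ ->] := insert_uniq yx' zx yz; first by rewrite /= yz.
Qed.

(** Lexicographic: first the defect of the height, then the dimension. The factor outweighs the one
    dimension gained along an upward edge. *)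
Definition potential n (O : X n) : nat :=
  ((lg S - height (rng (projT1 (cid (classP O))))) * (lg S).+2 + n)%N.

Lemma potential_class n (x : nerve C n) :
  potential (class x) = ((lg S - height (rng x)) * (lg S).+2 + n)%N.
Proof.
rewrite /potential; case: cid => y /= /class_eq[g ->].
by rewrite rng_conj height_conj //; exact: rng_chain.
Qed.

Lemma potential_up n (U : X n.+1) i : apex_at U i ->
  (potential U < potential (face i U))%N.
Proof.
move=> [y [-> yI ay]]; rewrite face_class !potential_class.
have [aF nF] := apex_face yI ay.
have := height_insert (rng_chain (face i y)) aF nF; rewrite -face_rng.
have := height_le (rng_chain y); nia.
Qed.

Lemma potential_down n (U : X n.+1) i j : apex_at U i -> j != i ->
  (potential (face j U) < potential U)%N.
Proof.
move=> [y [-> yI ay]] ji; rewrite face_class !potential_class.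
have := height_le (rng_chain y).
suff : (height (rng y) <= height (rng (face j y)))%N by nia.
apply: (height_sub (rng_chain y) (rng_chain _) ay).
- by exists i.
- by rewrite (face_rng j y) => P; left.
- rewrite rng_face //; split; first by exists i.
  by move=> /yI ij; rewrite ij eqxx in ji.
Qed.

Lemma exists_mates n : exists f : X n -> X n.+1 * 'I_n.+2,
  forall O, kind red_chain O ->
    apex_at (f O).1 (f O).2 /\ face (f O).2 (f O).1 = O.
Proof.
suff /choice[f fP] (O : X n) : exists f : X n.+1 * 'I_n.+2,
    kind red_chain O -> apex_at f.1 f.2 /\ face f.2 f.1 = O by exists f.
have [/red_mate[U [i [Ui UO]]]|nO] := pselect (kind red_chain O).
  by exists (U, i).
by exists (degeneracy ord0 O, ord0).
Qed.

Definition mates n : X n -> X n.+1 * 'I_n.+2 := projT1 (cid (exists_mates n)).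

Lemma matesP n (O : X n) : kind red_chain O ->
  apex_at (mates O).1 (mates O).2 /\ face (mates O).2 (mates O).1 = O.
Proof. by rewrite /mates; case: cid => f /= fP; exact: fP. Qed.

Lemma kind_cover n :
  @kind crit_chain n `|` @kind red_chain n `|` @kind coll_chain n =
  nondegenerate_simplex X n.
Proof.
apply/seteqP; split=> O.
  by case=> [[]|] [x [-> xI _]]; apply/nondegenerateP.
have [x ->] := classP O; move=> /nondegenerateP xI.
by have [?|[?|?]] := chain_cases (rng_chain x); [left; left|left; right|right];
  exists x.
Qed.

Lemma kind_disjoint n :
  [/\ @kind crit_chain n `&` @kind red_chain n = set0,
      @kind crit_chain n `&` @kind coll_chain n = set0 &
      @kind red_chain n `&` @kind coll_chain n = set0].
Proof.
split; apply/seteqP; split => // O [[x [-> _ kx]]] /kind_class[].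
- exact: red_chain_conj.
- by move=> _; have [h _ _] := chain_disjoint (rng_chain x); exact: h.
- exact: coll_chain_conj.
- by move=> _; have [_ h _] := chain_disjoint (rng_chain x); exact: h.
- exact: coll_chain_conj.
- by move=> _; have [_ _ h] := chain_disjoint (rng_chain x); exact: h.
Qed.

Lemma kind_coll0 : @kind coll_chain 0 = set0.
Proof.
apply/seteqP; split => // O [x [_ _ [Q _ [xQ]]]]; apply.
apply/seteqP; split => [_ [i _ <-]|_ ->//]; case: xQ => j _ <-.
by rewrite !ord1.
Qed.

Lemma mates_bij n :
  set_bij (@kind red_chain n) (@kind coll_chain n.+1) (fun O => (mates O).1).
Proof.
split.
- move=> O /matesP[aO _]; apply/coll_apex_at; by eexists; exact: aO.
- move=> O O' /set_mem/matesP[aO OE] /set_mem/matesP[aO' O'E] E.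
  by rewrite -OE -O'E; rewrite E in aO *; rewrite (apex_at_uniq aO aO').
- move=> U /coll_apex_at[i Ui]; exists (face i U); first exact: red_face.
  have [aU UE] := matesP (red_face Ui).
  exact: mate_uniq aU Ui UE erefl.
Qed.

Definition quotient_matching : matching X :=
  @Matching X (@kind crit_chain) (@kind red_chain) (@kind coll_chain)
    (fun n O => (mates O).1) (fun n O => (mates O).2)
    kind_cover kind_disjoint kind_coll0 mates_bij
    (fun n O Or => (matesP Or).2).

Lemma potential_edge s t : morse_edge quotient_matching s t ->
  (potential (projT2 t) < potential (projT2 s))%N.
Proof.
case=> [n O /matesP[aO OE]|n O U j /matesP[aO OE] -> /= ji _] /=.
  by rewrite -{2}OE; exact: potential_up.
exact: potential_down aO ji.
Qed.

Lemma quotient_matching_morse : morse_matching quotient_matching.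
Proof.
move=> [s sE]; have bound k : (potential (projT2 (s k)) + k <=
    potential (projT2 (s 0)))%N.
  elim: k => [|k IH]; first by rewrite addn0.
  by apply: leq_trans IH; rewrite addnS ltn_add2r; exact/potential_edge/sE.
have := bound (potential (projT2 (s 0))).+1.
by rewrite leqNgt leq_addl.
Qed.

Definition sylow_vertex : nerve C 0 :=
  exist _ (fun=> S) (conj (fun=> C_sylow) (fun _ _ _ => @subset_refl _ _)).

Lemma quotient_matching_critical :
  critical_cells quotient_matching = [set existT _ 0%N (class sylow_vertex)].
Proof.
apply/seteqP; split => [[n O]|_ ->]; rewrite /critical_cells /=.
  move=> [x [-> xI [Q aQ xQ]]]; case: n x xI aQ xQ {O} => [|n] x xI aQ xQ.
    have x0 : sval x ord0 = Q.
      by have : rng x (sval x ord0); [exists ord0|rewrite xQ].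
    rewrite xQ in aQ; have CQ : C Q by rewrite -x0; exact: (svalP x).1.
    have [g gQ] := apex_set1 CQ aQ.
    congr (existT _ 0%N _); rewrite -(class_conj Cconj x g); congr class.
    apply: nerve_simplex_inj; apply/funext => i /=.
    by rewrite ord1 x0.
  by have := rng_not1 xI xQ.
exists sylow_vertex; split=> //; first by move=> i j _; rewrite !ord1.
have xS : rng sylow_vertex = [set S].
  by apply/seteqP; split=> [_ [i _ <-]//|_ ->]; exists ord0.
by exists S; rewrite xS //; exact: apex_sylow.
Qed.

(** * The contraction *)

Variable R : realType.
Notation a := (lg S).
Notation I := 'I_a.+1.
Implicit Types (y : I -> set G) (B : {set I}) (w : 'rV[R]_a.+1).

Definition img y B : set (set G) := y @` [set i | i \in B].

(* A strict chain in [C] is encoded by the set [B] of the exponents of the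
   orders of its members, together with [y] whose value at an exponent in [B] is
   the member with that exponent; the values of [y] outside [B] are irrelevant.
   A weighted chain is then a pair [(y, w)] with [B = supp w]. *)
Definition graded y B : Prop :=
  [/\ B != finset.set0, forall i, i \in B -> C (y i) /\ lg (y i) = i &
      forall i j, i \in B -> j \in B -> (i <= j)%N -> y i `<=` y j].

Lemma graded_chain y B : graded y B -> chain_set (img y B).
Proof.
move=> [/set0Pn[i iB] yB ych]; split.
- by exists (y i), i.
- by move=> _ [j /yB[]] + _ <-.
- move=> _ _ [j jB <-] [k kB <-]; have [jk|/ltnW kj] := leqP j k.
    by left; exact: ych.
  by right; exact: ych.
Qed.

Lemma graded_sub y B B' : graded y B -> B' \subset B -> B' != finset.set0 ->
  graded y B'.
Proof.
move=> [_ yB ych] /fintype.subsetP BB B0; split=> // [i /BB|i j /BB iB /BB jB].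
  exact: yB.
exact: ych.
Qed.

Lemma graded_conj y y' B g : graded y B ->
  (forall i, i \in B -> y' i = conj_set (y i) g) -> graded y' B.
Proof.
move=> [B0 yB ych] yy; split => // [i iB|i j iB jB ij].
  by rewrite yy // lg_conj; have [/(Cconj g)] := yB i iB.
by rewrite !yy //; apply: conj_setS; exact: ych.
Qed.

Lemma img_conj y y' B g : (forall i, i \in B -> y' i = conj_set (y i) g) ->
  img y' B = conjs (img y B) g.
Proof. by move=> yy; rewrite /conjs /img image_comp; apply: eq_imagel. Qed.

Lemma graded_inj y B i j : graded y B -> i \in B -> j \in B ->
  y i = y j -> i = j.
Proof.
move=> [_ yB _] /yB[_ iE] /yB[_ jE] yij; apply: val_inj => /=.
by rewrite -[LHS]iE yij jE.
Qed.

(** Outside [B] the chain is filled with repetitions, so strict chains of every length become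
    simplices of the same dimension [a]. *)
Lemma graded_nerve y B : graded y B ->
  exists x : nerve C a, forall i, i \in B -> sval x i = y i.
Proof.
move=> [B0 yB ych]; have [f [fm fB fid]] := monotone_retraction B0.
have fC i : C (y (f i)) by have [] := yB _ (fB i).
have fch : is_chain (y \o f).
  by move=> i j ij; apply: ych => //; exact: fm.
by exists (exist _ (y \o f) (conj fC fch)) => i iB /=; rewrite fid.
Qed.

Lemma push_retraction w (f : I -> I) : (forall i, i \in supp w -> f i = i) ->
  push_row f w = w.
Proof.
move=> fid; apply/rowP => j; rewrite mxE big_mkcond /=.
rewrite (eq_bigr (fun i => if i == j then w ord0 i else 0%R)); last first.
  move=> i _; have [iw|] := boolP (i \in supp w); first by rewrite fid.
  by rewrite mem_supp negbK => /eqP ->; rewrite !if_same.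
by rewrite -big_mkcond big_pred1_eq.
Qed.

(* Pushing along a monotone retraction of the indices onto [supp t] does not
   change [t] and makes [x] and [x'] equal. *)
Lemma pt_agree (x x' : nerve C a) (t : std_simplex R a) :
  (forall i, i \in supp (set_val t) -> sval x i = sval x' i) ->
  pt (class x) t = pt (class x') t.
Proof.
move=> xx'; have tw : weights finset.setT (set_val t).
  by split; [exact: set_valP|exact: finset.subsetT].
have [f [fm fB fid]] := monotone_retraction (supp_neq0 tw).
pose h : {omorphism I -> I} := monotone_map fm.
have pt_f z : pt (class z) t = pt (class (smap h z)) t.
  rewrite -smap_class pt_smap; congr pt; apply: val_inj => /=.
  by rewrite push_retraction.
rewrite (pt_f x) (pt_f x'); congr pt; congr class.
by apply: nerve_simplex_inj; apply/funext => i /=; exact: xx'.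
Qed.

Lemma std_simplex0 : std_simplex R 0 (const_mx 1%R).
Proof.
split=> [i|]; first by rewrite mxE ler01.
by rewrite big_ord1 mxE.
Qed.

Definition base_point : realization R X :=
  pt (class (sylow_vertex))
     (exist _ (const_mx 1%R) (mem_set std_simplex0)).

(** A total function of the weights, so that continuity on a closed simplex can be stated with
    [within]; [base_point] is the value when no simplex fits. *)
Definition chain_pt y w : realization R X :=
  xget base_point [set u | exists (x : nerve C a) (t : std_simplex R a),
    [/\ set_val t = w, forall i, i \in supp w -> sval x i = y i &
        u = pt (class x) t]].

Lemma chain_ptE y (x : nerve C a) (t : std_simplex R a) :
  (forall i, i \in supp (set_val t) -> sval x i = y i) ->
  chain_pt y (set_val t) = pt (class x) t.
Proof.
move=> xy; rewrite /chain_pt; case: xgetP => [u _ [x' [t' [tt x'y ->]]]|/(_ _)].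
  rewrite (val_inj tt); apply: pt_agree => i iw.
  by rewrite xy // x'y.
by move=> /(_ (pt (class x) t)) []; exists x, t.
Qed.

Lemma chain_pt_conj y y' w g : graded y (supp w) -> weights (supp w) w ->
  (forall i, i \in supp w -> y' i = conj_set (y i) g) ->
  chain_pt y' w = chain_pt y w.
Proof.
move=> yw [ws _] yy; have [x xy] := graded_nerve yw.
pose t : std_simplex R a := exist _ w (mem_set ws).
rewrite -[w]/(set_val t) (chain_ptE (t := t) xy).
rewrite (chain_ptE (t := t) (x := nerve_conj Cconj x g)) ?class_conj //.
by move=> i iw /=; rewrite xy // yy.
Qed.

Lemma chain_pt_continuous y B : graded y B ->
  {within weights B, continuous (chain_pt y)}.
Proof.
move=> yB; have [x xy] := graded_nerve yB.
apply: (@within_eq _ _ (valL_ base_point (pt (class x)))); last first.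
  apply: (@continuous_subspaceW _ _ _ (std_simplex R a)); first by move=> w [].
  by apply/subspace_valL_continuousP'; exact: pt_continuous.
move=> w [ws wB]; pose t : std_simplex R a := exist _ w (mem_set ws).
have -> : valL_ base_point (pt (class x)) w = pt (class x) t.
  by have /(congr1 (fun h => h t)) := valLK base_point (pt (class x)).
rewrite -[w]/(set_val t); apply/esym/chain_ptE => i iw.
by apply: xy; exact: (fintype.subsetP wB).
Qed.


Lemma chain_pt_eq y y' w : graded y (supp w) -> weights (supp w) w ->
  (forall i, i \in supp w -> y' i = y i) -> chain_pt y' w = chain_pt y w.
Proof.
move=> yw ww yy; apply: (chain_pt_conj (g := 1)) => // i iw.
by rewrite conj_set1 yy.
Qed.

Lemma img_eq y y' B : (forall i, i \in B -> y' i = y i) -> img y' B = img y B.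
Proof. exact: eq_imagel. Qed.

(** * Insertion of the apex into a weighted chain, and the iterated flow *)

Definition apex_of y B : set G := xget set0 [set Q | apex (img y B) Q].

Definition apex_index y B : I := inord (lg (apex_of y B)).

Definition add_apex y B (i : I) : set G :=
  if i == apex_index y B then apex_of y B else y i.

Lemma apex_ofP y B : graded y B -> apex (img y B) (apex_of y B).
Proof. by move=> /graded_chain/apex_exists h; exact: (xgetPex set0 h). Qed.

Lemma apex_indexE y B : graded y B -> lg (apex_of y B) = apex_index y B.
Proof.
move=> yB; rewrite inordK // ltnS; apply: C_lg.
exact: apex_C (graded_chain yB) (apex_ofP yB).
Qed.

Lemma add_apexE y B : add_apex y B (apex_index y B) = apex_of y B.
Proof. by rewrite /add_apex eqxx. Qed.

(** If the index of the apex is already taken, the apex and [y i] have equal orders and lie in a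
    common chain, so they coincide. *)
Lemma add_apex_old y B i : graded y B -> i \in B -> add_apex y B i = y i.
Proof.
move=> yB iB; rewrite /add_apex; case: eqVneq => // iE.
have Ich := apex_insert_chain (graded_chain yB) (apex_ofP yB).
have lgE : lg (apex_of y B) = lg (y i).
  rewrite (apex_indexE yB) -iE.
  by have [_ yB' _] := yB; have [_ ->] := yB' i iB.
have yZ : (img y B `|` [set apex_of y B]) (y i) by left; exists i.
have aZ : (img y B `|` [set apex_of y B]) (apex_of y B) by right.
by apply/seteqP; split; apply/(chain_lg Ich) => //; rewrite lgE.
Qed.

Lemma img_add_apex y B : graded y B ->
  img (add_apex y B) (apex_index y B |: B) = img y B `|` [set apex_of y B].
Proof.
move=> yB; apply/seteqP; split => [_ [i /= + <-]|P [[i /= iB <-]|->]].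
- rewrite finset.in_setU1 => /orP[/eqP ->|iB].
    by right; rewrite add_apexE.
  by left; rewrite add_apex_old //; exists i.
- by exists i; rewrite ?add_apex_old //= finset.in_setU1 iB orbT.
- by exists (apex_index y B); rewrite ?add_apexE //= finset.in_setU1 eqxx.
Qed.

Lemma graded_add_apex y B : graded y B ->
  graded (add_apex y B) (apex_index y B |: B).
Proof.
move=> yB; have Ich := apex_insert_chain (graded_chain yB) (apex_ofP yB).
have lgE i : i \in apex_index y B |: B -> lg (add_apex y B i) = i.
  rewrite finset.in_setU1 => /orP[/eqP ->|iB].
    by rewrite add_apexE apex_indexE.
  by rewrite add_apex_old //; have [_ yB' _] := yB; have [_ ->] := yB' i iB.
have inZ i : i \in apex_index y B |: B ->
    (img y B `|` [set apex_of y B]) (add_apex y B i).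
  by move=> iB; rewrite -img_add_apex //; exists i.
split.
- by apply/set0Pn; exists (apex_index y B); rewrite finset.in_setU1 eqxx.
- move=> i iB; split; last exact: lgE.
  by have [_ ZC _] := Ich; apply: ZC; exact: inZ.
- move=> i j iB jB ij; apply/(chain_lg Ich); [exact: inZ|exact: inZ|].
  by rewrite !lgE.
Qed.

Lemma apex_add_apex y B : graded y B ->
  apex (img (add_apex y B) (apex_index y B |: B)) (apex_of y B).
Proof.
move=> yB; rewrite img_add_apex //.
exact: apex_insert (graded_chain yB) (apex_ofP yB).
Qed.

Definition rank y B : nat := ((a - height (img y B)) * a.+2 + #|B|)%N.

Lemma rank_add_apex y B : graded y B -> apex_index y B \notin B ->
  (rank (add_apex y B) (apex_index y B |: B) < rank y B)%N.
Proof.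
move=> yB nB; have ych := graded_chain yB.
have nZ : ~ img y B (apex_of y B).
  move=> [i /= iB iE]; move: nB; have [_ yB' _] := yB; have [_ lgi] := yB' i iB.
  suff -> : apex_index y B = i by rewrite iB.
  by apply: val_inj; rewrite /= -apex_indexE // -iE.
have := height_insert ych (apex_ofP yB) nZ; rewrite -img_add_apex //.
have := height_le (graded_chain (graded_add_apex yB)).
rewrite /rank cardsU1 nB.
have : (#|B| <= a.+1)%N by rewrite -[leqRHS]card_ord max_card.
move: (height _) (height _) => h1 h2; nia.
Qed.

(** Keeping the apex prevents the height from falling, and the cardinality drops. *)
Lemma rank_sub y B B' i : graded y B -> apex (img y B) (y i) -> i \in B ->
  B' \subset B -> i \in B' -> B' != B -> (rank y B' < rank y B)%N.
Proof.
move=> yB ai iB B'B iB' B'neB.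
have B'0 : B' != finset.set0 by apply/set0Pn; exists i.
have cB : (#|B'| < #|B|)%N.
  by apply: proper_card; rewrite finset.properEneq B'neB.
have : (height (img y B) <= height (img y B'))%N.
  apply: height_sub ai _ _ _.
  - exact: graded_chain.
  - exact: graded_chain (graded_sub yB B'B B'0).
  - by exists i.
  - by move=> _ [j /= /(fintype.subsetP B'B) jB <-]; exists j.
  - by exists i.
rewrite /rank; nia.
Qed.

Lemma rank_gt0 y B : B != finset.set0 -> (0 < rank y B)%N.
Proof. by rewrite -card_gt0 /rank addn_gt0 orbC => ->. Qed.

Lemma rank_le y B : (rank y B <= a * a.+2 + a.+1)%N.
Proof.
have : (#|B| <= a.+1)%N by rewrite -[leqRHS]card_ord max_card.
rewrite /rank; nia.
Qed.

(** [k] bounds the number of restarts and [s] is the time left. Once the time is used up, the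
    remaining rounds move nothing. *)
Fixpoint descend k y w (s : R) : realization R X :=
  if k is k'.+1 then
    let B := supp w in
    descend k' (add_apex y B) (flow B (apex_index y B) w s)
      (s - Num.min s (gap B (apex_index y B) w))%R
  else chain_pt y w.

Lemma descendS k y w s (B := supp w) (i := apex_index y B) :
  descend k.+1 y w s = descend k (add_apex y B) (flow B i w s)
    (s - Num.min s (gap B i w))%R.
Proof. by []. Qed.

Definition graded_point y w := graded y (supp w) /\ weights (supp w) w.

Lemma graded_point_step y w s : graded_point y w -> (0 <= s)%R ->
  graded_point (add_apex y (supp w))
    (flow (supp w) (apex_index y (supp w)) w s).
Proof.
move=> [yw ww] s0; have [sf fB] := flow_weights (apex_index y (supp w)) ww s0.
split=> //; apply: (graded_sub (graded_add_apex yw) fB).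
apply: (@supp_neq0 _ _ finset.setT).
by split; [exact: sf|exact: finset.subsetT].
Qed.

Lemma gap_graded_point y w j : graded_point y w -> (0 <= gap (supp w) j w)%R.
Proof. by move=> [_ ww]; exact: gap_ge0 ww. Qed.

Lemma time_ge0 w j s : (0 <= s)%R -> (0 <= s - Num.min s (gap (supp w) j w))%R.
Proof. by move=> s0; rewrite subr_ge0 ge_min lexx. Qed.

Lemma descend0 k y w : graded_point y w -> descend k y w 0%R = chain_pt y w.
Proof.
elim: k y w => //= k IH y w gyw; have [yw ww] := gyw.
rewrite (min_idPl (gap_graded_point _ gyw)) subr0 (flow0 _ _ ww).
have gs := graded_point_step gyw (lexx 0%R); rewrite (flow0 _ _ ww) in gs.
rewrite IH //; apply: chain_pt_eq => // i iw; exact: add_apex_old.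
Qed.

Lemma descend_fixed k y w s : graded_point y w ->
  supp w \subset [set apex_index y (supp w)]%SET -> (0 <= s)%R ->
  descend k y w s = chain_pt y w.
Proof.
elim: k y w s => //= k IH y w s gyw wj s0; have [yw ww] := gyw.
have gs := graded_point_step gyw s0; rewrite (flow_fixed _ _ wj) in gs *.
set y' := add_apex y (supp w) in gs *.
have yy' i : i \in supp w -> y' i = y i by exact: add_apex_old.
rewrite IH //; [exact: chain_pt_eq| |exact: time_ge0].
suff -> : apex_index y' (supp w) = apex_index y (supp w) by [].
by rewrite /apex_index /apex_of (img_eq yy').
Qed.

Lemma rank_step y w s i : graded_point y w -> i \in supp w ->
  i != apex_index y (supp w) ->
  (gap (supp w) (apex_index y (supp w)) w <= s)%R ->
  (rank (add_apex y (supp w))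
     (supp (flow (supp w) (apex_index y (supp w)) w s)) < rank y (supp w))%N.
Proof.
move=> [yw ww] iw ij gs; set j := apex_index _ _ in ij gs *.
have [Bsub jB [k]] := flow_hit ww iw ij gs; rewrite finset.in_setD1.
move=> /andP[kj kw] kB; set B := supp (flow _ _ _ _) in Bsub jB kB *.
have h : (rank (add_apex y (supp w)) B <
          rank (add_apex y (supp w)) (j |: supp w))%N.
  apply: (rank_sub (i := j)) => //; first exact: graded_add_apex.
  - by rewrite add_apexE; exact: apex_add_apex.
  - by rewrite finset.in_setU1 eqxx.
  - by apply: contraNneq kB => ->; rewrite finset.in_setU1 kw orbT.
have [jw|jw] := boolP (j \in supp w); last first.
  exact: ltn_trans h (rank_add_apex yw jw).
apply: leq_trans h _; have -> : j |: supp w = supp w.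
  by apply/finset.setUidPr; rewrite finset.sub1set.
suff -> : rank (add_apex y (supp w)) (supp w) = rank y (supp w) by [].
by rewrite /rank (img_eq (y := y)) // => l; exact: add_apex_old.
Qed.

Lemma graded_point_cases y w s : graded_point y w -> (0 <= s)%R ->
  let j := apex_index y (supp w) in
  [\/ supp w \subset [set j]%SET, (s <= gap (supp w) j w)%R |
      (gap (supp w) j w <= s)%R /\
      (rank (add_apex y (supp w)) (supp (flow (supp w) j w s)) <
       rank y (supp w))%N].
Proof.
move=> gyw s0 j; have [wj|] := boolP (supp w \subset [set j]%SET).
  by apply: Or31.
move=> /fintype.subsetPn[i iw]; rewrite finset.in_set1 => ij.
have [sg|/ltW gs] := leP s (gap (supp w) j w); first exact: Or32.
by apply: Or33; split => //; exact: rank_step iw ij gs.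
Qed.

(** In each round the point is at rest, or its time runs out, or its rank drops; so no more rounds
    than the rank are needed. *)
Lemma descend_stable k y w s : graded_point y w -> (0 <= s)%R ->
  (rank y (supp w) <= k)%N -> descend k.+1 y w s = descend k y w s.
Proof.
elim: k y w s => [|k IH] y w s gyw s0.
  by rewrite leqn0 => /eqP r0; have := rank_gt0 y (supp_neq0 gyw.2); rewrite r0.
move=> rk; case: (graded_point_cases gyw s0) => [wj|sg|[gs rs]].
- by rewrite !(descend_fixed _ gyw wj).
- have gs := graded_point_step gyw s0.
  by rewrite /= (min_idPl sg) subrr !(descend0 _ gs) -?(descend0 k.+1 gs).
- have rk' := leq_trans rs rk; rewrite ltnS in rk'.
  rewrite (descendS k.+1) (descendS k).
  by apply: IH => //; [exact: graded_point_step|exact: time_ge0].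
Qed.

(** The apexes chosen for the two conjugate chains need not correspond under [g]. An element [h]
    fixing the second chain corrects this, and the induction continues with [g * h]. *)
Lemma descend_conj k y y' w s g : graded_point y w -> (0 <= s)%R ->
  (forall i, i \in supp w -> y' i = conj_set (y i) g) ->
  descend k y' w s = descend k y w s.
Proof.
elim: k y y' w s g => [|k IH] y y' w s g gyw s0 yy; have [yw ww] := gyw.
  exact: chain_pt_conj yy.
have y'w := graded_conj yw yy; have imE := img_conj yy.
have aQ := @apex_conj _ _ g (apex_ofP yw); rewrite -imE in aQ.
have [h hfix hQ] := apex_uniq (graded_chain y'w) aQ (apex_ofP y'w).
have jE : apex_index y' (supp w) = apex_index y (supp w).
  by rewrite /apex_index -hQ !lg_conj.
rewrite !descendS jE; apply: (IH _ _ _ _ (g * h)).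
  exact: graded_point_step.
  exact: time_ge0.
have [_ /fintype.subsetP fB] := flow_weights (apex_index y (supp w)) ww s0.
move=> i /fB; rewrite finset.in_setU1 conj_setM => iB.
have [ij|ij] := eqVneq i (apex_index y (supp w)).
  by rewrite {1}ij -{1}jE ij !add_apexE hQ.
move: iB; rewrite (negbTE ij) /= => iw.
by rewrite !add_apex_old // -yy // hfix //; exists i.
Qed.

(** The apex picked by [apex_of] may be replaced by any other, by [descend_conj] with an element
    that fixes the chain. *)
Lemma descend_apex k y y' w s (j : I) : graded_point y w -> (0 <= s)%R ->
  (forall i, i \in supp w -> y' i = y i) ->
  apex (img y (supp w)) (y' j) -> lg (y' j) = j ->
  descend k.+1 y w s = descend k y' (flow (supp w) j w s)
    (s - Num.min s (gap (supp w) j w))%R.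
Proof.
move=> gyw s0 yy aj lgj; have [yw ww] := gyw.
have [h hfix hQ] := apex_uniq (graded_chain yw) (apex_ofP yw) aj.
have jE : apex_index y (supp w) = j.
  by apply: val_inj; rewrite /= -apex_indexE // -lgj -hQ lg_conj.
rewrite descendS jE; apply/esym; apply: (@descend_conj _ _ _ _ _ h).
- by rewrite -jE; exact: graded_point_step.
- exact: time_ge0.
have [_ /fintype.subsetP fB] := flow_weights j ww s0.
move=> i /fB; rewrite finset.in_setU1; have [->|ij] := eqVneq i j.
  by move=> _; rewrite -{2}jE add_apexE hQ.
by move=> /= iw; rewrite add_apex_old // yy // hfix //; exists i.
Qed.

(** The bound of [rank_le]. It serves both as the number of rounds and, each moving round lasting at
    most one unit, as the total time. *)
Definition time_bound := (a * a.+2 + a.+1)%N.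

Definition contraction := descend time_bound.

Lemma img_remove y B j : graded y B -> j \in B ->
  img y (B :\ j)%SET = img y B `\ y j.
Proof.
move=> yB jB; apply/seteqP; split => [_ [i /= + <-]|P [[i /= iB <-] ij]].
  rewrite finset.in_setD1 => /andP[ij iB]; split; first by exists i.
  by move=> /(graded_inj yB iB jB) ijE; rewrite ijE eqxx in ij.
exists i => //=; rewrite finset.in_setD1 iB andbT; apply/eqP => ijE.
by apply: ij; rewrite ijE.
Qed.

Lemma graded_point_sub y B w : graded y B -> weights B w -> graded_point y w.
Proof.
move=> yB wB; split; last exact: weights_id wB.
by apply: graded_sub yB _ (supp_neq0 wB); case: wB.
Qed.

(* On a closed face of a matched simplex the flow may be computed as if the
   point was interior: nothing moves when [gap B j w] is zero, and otherwise
   [B] is [supp w] with [j] possibly added. *)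
Lemma contraction_flow y B (j : I) w s : graded y B -> j \in B ->
  apex (img y B) (y j) -> weights B w -> (0 <= s)%R ->
  contraction y w s =
  contraction y (flow B j w s) (s - Num.min s (gap B j w))%R.
Proof.
move=> yB jB aj wB s0; have gyw := graded_point_sub yB wB.
have := gap_ge0 B j wB; rewrite le_eqVlt => /orP[/eqP d0|d0].
  rewrite /flow -d0 (min_idPr s0) scale0r addr0 subr0 //.
have Bw : (B :\ j = supp w :\ j)%SET.
  apply/eqP; rewrite finset.eqEsubset finset.subsetD1 (gap_gt0 d0).
  rewrite finset.setD11 /=; apply: finset.setSD; exact: wB.2.
have iBw i : i != j -> (i \in B) = (i \in supp w).
  by move=> ij; have /setP/(_ i) := Bw; rewrite !finset.in_setD1 ij.
have -> : gap B j w = gap (supp w) j w by rewrite /gap Bw.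
have -> : flow B j w s = flow (supp w) j w s.
  apply/rowP => i; rewrite !flowE /gap Bw; case: eqVneq => // ij.
  by rewrite iBw.
have lgj : lg (y j) = j by have [_ yB' _] := yB; have [] := yB' j jB.
rewrite /contraction -descend_stable ?rank_le //.
apply: (descend_apex _ gyw) => //.
have [jw|jw] := boolP (j \in supp w).
  suff -> : supp w = B by [].
  by apply/setP => i; have [->|/iBw ->//] := eqVneq i j; rewrite jw jB.
have wE : supp w = (B :\ j)%SET.
  apply/setP => i; rewrite finset.in_setD1; have [->|/iBw ->//] := eqVneq i j.
  exact/negbTE.
rewrite wE img_remove //; apply: apex_remove => //; first exact: graded_chain.
  by exists j.
move=> y1; have /set0Pn[i] := supp_neq0 wB; rewrite wE finset.in_setD1.
move=> /andP[ij iB]; have : img y B (y i) by exists i.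
by rewrite y1 => /(graded_inj yB iB jB) ijE; rewrite ijE eqxx in ij.
Qed.

Lemma coord_fst_continuous i :
  continuous (fun x : 'rV[R]_a.+1 * R => x.1 ord0 i).
Proof.
move=> x; apply: (continuous_comp (f := fst) (g := fun w => w ord0 i)).
  exact: cvg_fst.
exact: coord_continuous.
Qed.

Lemma gap_continuous B j :
  continuous (fun x : 'rV[R]_a.+1 * R => gap B j x.1).
Proof. by apply: continuous_bigmin => i; exact: coord_fst_continuous. Qed.

Lemma min_gap_continuous B j :
  continuous (fun x : 'rV[R]_a.+1 * R => Num.min x.2 (gap B j x.1)).
Proof.
move=> x; apply: continuous_min; first exact: cvg_snd.
exact: gap_continuous.
Qed.

Lemma flow_continuous B j :
  continuous (fun x : 'rV[R]_a.+1 * R => flow B j x.1 x.2).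
Proof.
apply: continuous_row => i x.
pose c : R :=
  (if i == j then #|(B :\ j)%SET|%:R else if i \in B then -1 else 0)%R.
have -> : (fun x : 'rV[R]_a.+1 * R => flow B j x.1 x.2 ord0 i) =
    (fun x => x.1 ord0 i + Num.min x.2 (gap B j x.1) * c)%R.
  by apply/funext => z; rewrite flowE.
apply: (@cvgD _ R^o); first exact: coord_fst_continuous.
by apply: cvgM; [exact: min_gap_continuous|exact: cvg_cst].
Qed.

Lemma closed_le_fun (T : topologicalType) (f h : T -> R) :
  continuous f -> continuous h -> closed [set x | (f x <= h x)%R].
Proof.
move=> cf ch; have -> : [set x | (f x <= h x)%R] =
    (fun x => h x - f x)%R @^-1` [set r | (0 <= r)%R].
  by apply/seteqP; split => x /=; rewrite subr_ge0.
apply: closed_comp; last exact: closed_ge.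
by move=> x _; apply: continuousB; [exact: ch|exact: cf].
Qed.

Definition halfspace B : set ('rV[R]_a.+1 * R) :=
  [set x | weights B x.1 /\ (0 <= x.2)%R].

Lemma contraction_continuous y B : graded y B ->
  {within halfspace B, continuous (fun x => contraction y x.1 x.2)}.
Proof.
have [r] := ubnP (rank y B); elim: r y B => // r IH y B rk yB.
set j := apex_index y B.
(* A missing apex is inserted at once: this lowers the rank, and the old simplex is a face of the
   new one. *)
have [jB|jB] := boolP (j \in B); last first.
  apply: (@within_eq _ _ (fun x => contraction (add_apex y B) x.1 x.2)).
    move=> x [xB x0]; apply: (@descend_conj _ _ _ _ _ 1) => //.
      exact: graded_point_sub yB xB.
    move=> i /(fintype.subsetP xB.2) iB.
    by rewrite conj_set1 add_apex_old.
  apply: (@continuous_subspaceW _ _ _ (halfspace (j |: B))).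
    move=> x [xB x0]; split => //; apply: weightsS xB.
    exact: finset.subsetU1.
  apply: IH (graded_add_apex yB); apply: leq_trans (rank_add_apex yB jB) _.
  by rewrite -ltnS.
have yj : y j = apex_of y B by rewrite -add_apexE add_apex_old.
have aj : apex (img y B) (y j) by rewrite yj; exact: apex_ofP.
have jUB : j |: B = B by apply/finset.setUidPr; rewrite finset.sub1set.
have fB x : halfspace B x -> weights B (flow B j x.1 x.2).
  by move=> [xB x0]; rewrite -{1}jUB; exact: flow_weights.
have [Bj|] := boolP (B \subset [set j]%SET).
  apply: (@within_eq _ _ (fun x => chain_pt y x.1)); last first.
    apply: (@within_comp _ _ _ fst _ _ (weights B)) (chain_pt_continuous yB).
      by move=> x; exact: cvg_fst.
    by move=> x [].
  move=> x [xB x0]; have gyx := graded_point_sub yB xB.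
  apply/esym/descend_fixed => //.
  have -> : supp x.1 = B.
    apply/eqP; rewrite finset.eqEsubset xB.2 /=.
    apply: (fintype.subset_trans Bj).
    have /set0Pn[i ix] := supp_neq0 xB; rewrite finset.sub1set.
    have := fintype.subsetP Bj _ (fintype.subsetP xB.2 _ ix).
    by rewrite finset.in_set1 => /eqP <-.
  exact: Bj.
move=> /fintype.subsetPn[i iB]; rewrite finset.in_set1 => ij.
(* On the piece [None] the time runs out within the first round. On the piece [Some k] the weight
   [k] is among the first to vanish, and the first round ends on the face [B :\ k], where the
   induction hypothesis applies. *)
pose E (k : option I) : set ('rV[R]_a.+1 * R) := if k is Some k then
    if k \in (B :\ j)%SET then
      [set x : 'rV[R]_a.+1 * R | (x.1 ord0 k <= gap B j x.1)%R] `&`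
      [set x : 'rV[R]_a.+1 * R | (gap B j x.1 <= x.2)%R]
    else set0
  else [set x : 'rV[R]_a.+1 * R | (x.2 <= gap B j x.1)%R].
have c2 : continuous (snd : 'rV[R]_a.+1 * R -> R) by move=> x; exact: cvg_snd.
apply: (@within_closed_cover _ _ _ E).
- case=> [k|]; last by apply: closed_le_fun => //; exact: gap_continuous.
  rewrite /E; case: ifP => _; last exact: closed0.
  apply: closedI; apply: closed_le_fun => //; try exact: gap_continuous.
  exact: coord_fst_continuous.
- move=> x [xB x0]; have [xg|/ltW gx] := leP x.2 (gap B j x.1).
    by exists None.
  have [k [kB kj kx]] := gap_attained xB iB ij; exists (Some k).
  by rewrite /E finset.in_setD1 kj kB; split => //=; rewrite kx.
case=> [k|]; last first.
  apply: (@within_eq _ _ (chain_pt y \o (fun x => flow B j x.1 x.2)));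
    last first.
    apply: within_comp (chain_pt_continuous yB); first exact: flow_continuous.
    by move=> x [xD _]; exact: fB.
  move=> x [[xB x0] /= xg].
  rewrite (contraction_flow yB jB aj xB x0) (min_idPl xg) subrr.
  by apply/esym/descend0; apply: graded_point_sub yB _; exact: fB.
rewrite /E; case: ifPn; last first.
  by rewrite setI0 => _; exact: continuous_subspace0.
rewrite finset.in_setD1 => /andP[kj kB].
pose h (x : 'rV[R]_a.+1 * R) :=
  (flow B j x.1 x.2, x.2 - Num.min x.2 (gap B j x.1))%R.
apply: (@within_eq _ _ ((fun x => contraction y x.1 x.2) \o h)).
  by move=> x [[xB x0] _]; rewrite /= -(contraction_flow yB jB aj xB x0).
have jBk : j \in (B :\ k)%SET by rewrite finset.in_setD1 eq_sym kj.
have rkB : (rank y (B :\ k)%SET < rank y B)%N.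
  apply: (rank_sub yB aj) => //; first exact: finset.subsetDl.
  by apply/eqP => /setP/(_ k); rewrite finset.in_setD1 eqxx kB.
apply: (@within_comp _ _ _ _ _ _ (halfspace (B :\ k)%SET)).
- have ct : continuous (fun x : 'rV[R]_a.+1 * R =>
      x.2 - Num.min x.2 (gap B j x.1))%R.
    by move=> x; apply: (@cvgB _ R^o); [exact: c2|exact: min_gap_continuous].
  move=> x; have := cvg_pair (@flow_continuous B j x) (ct x); exact.
- move=> x [[xB x0] [/= xk gx]]; split => /=; last first.
    by rewrite subr_ge0 ge_min lexx.
  have [fs fsub] := fB x (conj xB x0); split => //.
  have xkE : x.1 ord0 k = gap B j x.1.
    by apply/eqP; rewrite eq_le gap_le // andbT.
  by rewrite finset.subsetD1 fsub mem_supp negbK (flow_zero (k := k)) ?eqxx.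
- apply: IH; first by apply: leq_trans rkB _; rewrite -ltnS.
  by apply: graded_sub yB _ _; [exact: finset.subsetDl|apply/set0Pn; exists j].
Qed.

(** * Transfer of the flow to the geometric realization *)

Definition grade n (x : nerve C n) (i : 'I_n.+1) : I := inord (lg (sval x i)).

Lemma gradeE n (x : nerve C n) i : grade x i = lg (sval x i) :> nat.
Proof. by rewrite inordK // ltnS; apply/C_lg/(svalP x).1. Qed.

Lemma grade_homo n (x : nerve C n) : {homo grade x : i j / (i <= j)%O}.
Proof.
move=> i j; rewrite !leEord !gradeE => ij.
have [xi xj] : rng x (sval x i) /\ rng x (sval x j).
  by split; [exists i|exists j].
by apply/(chain_lg (rng_chain x) xi xj); exact: (svalP x).2.
Qed.

Definition graded_of n (x : nerve C n) (e : I) : set G :=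
  xget set0 [set P | rng x P /\ lg P = e].

Lemma graded_ofE n (x : nerve C n) i : graded_of x (grade x i) = sval x i.
Proof.
have xi : exists P, rng x P /\ lg P = grade x i.
  by exists (sval x i); rewrite gradeE; split => //; exists i.
have [xP lgP'] := xgetPex set0 xi.
rewrite -/(graded_of x (grade x i)) in xP lgP'.
have {}xi : rng x (sval x i) by exists i.
by apply/seteqP; split; apply/(chain_lg (rng_chain x)) => //;
  rewrite lgP' gradeE.
Qed.

Definition grades n (x : nerve C n) : {set I} :=
  [set grade x i | i in 'I_n.+1]%SET.

Lemma graded_of_graded n (x : nerve C n) : graded (graded_of x) (grades x).
Proof.
split.
- by apply/set0Pn; exists (grade x ord0); exact: imset_f.
- move=> _ /imsetP[i _ ->]; rewrite graded_ofE gradeE; split => //.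
  exact: (svalP x).1.
- move=> _ _ /imsetP[i _ ->] /imsetP[j _ ->]; rewrite !graded_ofE !gradeE.
  by apply: (chain_lg (rng_chain x) _ _).2; [exists i|exists j].
Qed.

Definition grade_weights n (x : nerve C n) (t : std_simplex R n) :
    'rV[R]_a.+1 :=
  push_row (grade x) (set_val t).

Lemma grade_weightsP n (x : nerve C n) (t : std_simplex R n) :
  weights (grades x) (grade_weights x t).
Proof.
split; first by apply: set_mem; exact: push_row_subproof.
apply/fintype.subsetP => j; rewrite mem_supp mxE; apply: contraNT => jx.
rewrite big_pred0 // => i; apply/negbTE; apply: contra jx => /eqP <-.
exact: imset_f.
Qed.

Lemma graded_point_grade n (x : nerve C n) (t : std_simplex R n) :
  graded_point (graded_of x) (grade_weights x t).
Proof. exact: graded_point_sub (graded_of_graded x) (grade_weightsP x t). Qed.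

Lemma push_row_comp l m n (f : 'I_l.+1 -> 'I_m.+1) (h : 'I_m.+1 -> 'I_n.+1)
    (t : 'rV[R]_l.+1) : push_row h (push_row f t) = push_row (h \o f) t.
Proof.
apply/rowP => j; rewrite !mxE (partition_big f (fun i => h i == j)) //=.
apply: eq_bigr => i /eqP ij; rewrite mxE; apply: eq_bigl => k.
by case: (eqVneq (f k) i) => [->|]; rewrite ?ij ?eqxx ?andbF.
Qed.

(** [x] is the pullback along [grade x] of a simplex of dimension [a], and the relation defining the
    realization moves this map to the weights, adding those of repeated members. *)
Lemma grade_pt n (x : nerve C n) (t : std_simplex R n) :
  chain_pt (graded_of x) (grade_weights x t) = pt (class x) t.
Proof.
have [z zx] := graded_nerve (graded_of_graded x).
pose f : {omorphism 'I_n.+1 -> I} := monotone_map (@grade_homo n x).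
have -> : class x = smap f (class z).
  rewrite smap_class; congr class.
  apply: nerve_simplex_inj; apply/funext => i /=.
  by rewrite zx ?graded_ofE //; exact: imset_f.
rewrite pt_smap -[grade_weights x t]/(set_val (push_simplex f t)).
apply: chain_ptE => i iw; apply: zx.
exact: (fintype.subsetP (grade_weightsP x t).2).
Qed.

Definition contract_simplex (u : prerealization R X) (s : R) :
    realization R X :=
  let x := projT1 (cid (classP (projT2 (projT1 u)))) in
  contraction (graded_of x) (grade_weights x (projT2 u)) s.

Lemma contract_simplexE n (x : nerve C n) (t : std_simplex R n) (s : R) :
  (0 <= s)%R ->
  contract_simplex (existT _ (existT _ n (class x)) t) s =
  contraction (graded_of x) (grade_weights x t) s.
Proof.
move=> s0; rewrite /contract_simplex /=; case: cid => z /= /class_eq[g ->].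
have gE i : grade (nerve_conj Cconj x g) i = grade x i.
  by apply: val_inj; rewrite /= !gradeE lg_conj.
have -> : grade_weights (nerve_conj Cconj x g) t = grade_weights x t.
  by apply/rowP => j; rewrite !mxE; apply: eq_bigl => i; rewrite gE.
apply: (@descend_conj _ _ _ _ _ g) => //; first exact: graded_point_grade.
move=> j /(fintype.subsetP (grade_weightsP x t).2) /imsetP[i _ ->].
by rewrite -{1}gE !graded_ofE.
Qed.

Lemma contract_step (u v : prerealization R X) (s : R) : (0 <= s)%R ->
  realization_step u v -> contract_simplex u s = contract_simplex v s.
Proof.
move=> s0 [m n f O t]; have [x ->] := classP O.
rewrite smap_class !contract_simplexE //.
have -> : grade_weights (smap f x) t = grade_weights x (push_simplex f t).
  by rewrite /grade_weights /= push_row_comp.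
apply: (@descend_conj _ _ _ _ _ 1) => //; first exact: graded_point_grade.
(* Going back to the weights of [smap f x] shows that their support consists of grades of
   [smap f x], where both chains are known. *)
rewrite -[grade_weights x _](_ : grade_weights (smap f x) t = _); last first.
  by rewrite /grade_weights /= push_row_comp.
move=> j /(fintype.subsetP (grade_weightsP (smap f x) t).2) /imsetP[i _ ->].
rewrite graded_ofE conj_set1 -[RHS](_ : sval x (f i) = _) //.
exact: esym (graded_ofE x (f i)).
Qed.

Lemma contract_repr (u : prerealization R X) (s : R) : (0 <= s)%R ->
  contract_simplex (generic_quotient.repr (\pi_(realization R X)%qT u)) s =
  contract_simplex u s.
Proof.
move=> s0; set v := generic_quotient.repr _.
have /eqquotP/asboolP : (\pi_({eq_quot realization_equiv R X})%qT v =
    \pi_({eq_quot realization_equiv R X})%qT u)%qT by rewrite reprK.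
elim=> [? ? /(contract_step s0)|//|? ? _ ->|? ? ? _ -> _ ->] //.
Qed.

Lemma std_simplex0E (t : std_simplex R 0) : set_val t = const_mx 1%R.
Proof.
have [_] := set_valP t; rewrite big_ord1 => t1.
by apply/rowP => i; rewrite mxE ord1.
Qed.

(** The constant chain at [S] in dimension [a] is a degeneracy of the Sylow vertex. *)
Lemma chain_pt_base y w (j : I) : graded_point y w -> supp w = [set j]%SET ->
  (exists g, conj_set (y j) g = S) -> chain_pt y w = base_point.
Proof.
move=> [yw [ws wsupp]] wj [g yg].
rewrite -(@chain_pt_conj y (fun=> S) w g) //; last first.
  by move=> i; rewrite wj finset.in_set1 => /eqP ->.
have chom : {homo (fun=> ord0) : i k / (i <= k :> I)%O >-> (i <= k :> 'I_1)%O}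
  by [].
pose f : {omorphism I -> 'I_1} := monotone_map chom.
pose t : std_simplex R a := exist _ w (mem_set ws).
rewrite -[w]/(set_val t).
rewrite (chain_ptE (x := smap f (sylow_vertex))) //.
rewrite -smap_class pt_smap; congr pt; apply: val_inj.
exact: (std_simplex0E (push_simplex f t)).
Qed.

(** A round that moves the point takes at most one unit of time, since gaps are at most 1, and
    lowers the rank. The motion can only stop at a critical chain. *)
Lemma descend_end k y w s : graded_point y w -> (rank y (supp w) <= k)%N ->
  (k%:R <= s)%R -> descend k y w s = base_point.
Proof.
elim: k y w s => [|k IH] y w s gyw rk ks.
  by have := rank_gt0 y (supp_neq0 gyw.2); rewrite ltnNge rk.
have s1 : (1 <= s)%R by apply: le_trans ks; rewrite ler1n.
have s0 : (0 <= s)%R by exact: le_trans s1.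
have [yw ww] := gyw; set j := apex_index y (supp w).
have [wj|] := boolP (supp w \subset [set j]%SET).
  have {}wj : supp w = [set j]%SET.
    by apply/eqP; move: wj; rewrite finset.subset1 (negbTE (supp_neq0 ww)) orbF.
  have jw : j \in supp w by rewrite wj finset.in_set1.
  rewrite (descend_fixed _ gyw) // -/j ?wj //; apply: (chain_pt_base gyw wj).
  have yj : y j = apex_of y (supp w) by rewrite -add_apexE add_apex_old.
  have imE : img y (supp w) = [set y j].
    rewrite wj; apply/seteqP; split => [_ [i /= + <-]|_ ->].
      by rewrite finset.in_set1 => /eqP ->.
    by exists j; rewrite //= finset.in_set1.
  have := apex_ofP yw; rewrite -yj imE; apply: apex_set1.
  by have [_ yB _] := yw; have [] := yB j jw.
move=> /fintype.subsetPn[i iw]; rewrite finset.in_set1 => ij.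
have gs : (gap (supp w) j w <= s)%R by exact: le_trans (gap_le1 _ _ _) s1.
have rs := leq_trans (rank_step gyw iw ij gs) rk; rewrite ltnS in rs.
rewrite descendS; apply: IH => //; first exact: graded_point_step.
rewrite (min_idPr gs) lerBrDr; apply: le_trans ks.
by rewrite -[in leRHS]natr1 lerD2l gap_le1.
Qed.

Local Open Scope ring_scope.

(** Truncating negative times gives a map that is continuous on the whole locally compact line, not
    only on the unit interval. *)
Definition homotopy (u : realization R X) (s : R) : realization R X :=
  contract_simplex (generic_quotient.repr u) (time_bound%:R * Num.max 0 s).

Lemma homotopy_time_ge0 (s : R) : 0 <= time_bound%:R * Num.max 0 s :> R.
Proof. by rewrite mulr_ge0 // le_max lexx. Qed.

Lemma homotopyE n (x : nerve C n) (t : std_simplex R n) s :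
  homotopy (pt (class x) t) s =
  contraction (graded_of x) (grade_weights x t) (time_bound%:R * Num.max 0 s).
Proof.
rewrite /homotopy contract_repr ?homotopy_time_ge0 //.
by rewrite contract_simplexE // homotopy_time_ge0.
Qed.

Lemma homotopy0 u : homotopy u 0 = u.
Proof.
have [n [w [t ->]]] := realization_ptP u; have [x ->] := classP w.
rewrite homotopyE maxxx mulr0 -grade_pt.
apply: descend0; exact: graded_point_grade.
Qed.

Lemma homotopy1 u : homotopy u 1 = base_point.
Proof.
have [n [w [t ->]]] := realization_ptP u; have [x ->] := classP w.
rewrite homotopyE (max_idPr _) // mulr1; apply: descend_end => //.
- exact: graded_point_grade.
- exact: rank_le.
Qed.

Lemma grade_weights_continuous n (x : nerve C n) :
  continuous (grade_weights x : std_simplex R n -> _).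
Proof.
apply: continuous_row => j.
have -> : (fun t : std_simplex R n => grade_weights x t ord0 j) =
    (fun t : std_simplex R n => \sum_(i | grade x i == j) set_val t ord0 i).
  by apply/funext => u; rewrite mxE.
apply: continuous_sumr => i t.
apply: (continuous_comp (f := set_val) (g := fun w : 'rV[R]_n.+1 => w ord0 i)).
  exact: initial_continuous.
exact: coord_continuous.
Qed.

Lemma contraction_simplex_continuous n (x : nerve C n) :
  continuous (fun ts : std_simplex R n * R =>
    contraction (graded_of x) (grade_weights x ts.1)
      (time_bound%:R * Num.max 0 ts.2)).
Proof.
pose h (ts : std_simplex R n * R) :=
  (grade_weights x ts.1, time_bound%:R * Num.max 0 ts.2).
apply/continuous_subspace_setT.
apply: (@within_comp _ _ _ h (fun z => contraction (graded_of x) z.1 z.2) _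
  (halfspace (grades x))).
- have c1 : continuous (fun ts : std_simplex R n * R => grade_weights x ts.1).
    move=> ts; apply: (continuous_comp (f := fst) (g := grade_weights x)).
      exact: cvg_fst.
    exact: grade_weights_continuous.
  have c2 : continuous (fun ts : std_simplex R n * R =>
      time_bound%:R * Num.max 0 ts.2).
    move=> ts; apply: cvgM; first exact: cvg_cst.
    by apply: continuous_max; [exact: cvg_cst|exact: cvg_snd].
  move=> ts; have := cvg_pair (c1 ts) (c2 ts); exact.
- move=> ts _; split; first exact: grade_weightsP.
  exact: homotopy_time_ge0.
- exact: contraction_continuous (graded_of_graded x).
Qed.

Import ArrowAsCompactOpen.

(** The product of a quotient map with [R] is not at once a quotient map. In curried form, with
    values in the compact-open topology, continuity can be tested on single simplices; local
    compactness of [R] then permits uncurrying. *)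
Lemma homotopy_curry_continuous :
  continuous (homotopy : realization R X -> (R -> realization R X)).
Proof.
apply/quotient_continuous.
pose f (nO : {n & X n}) (t : std_simplex R (projT1 nO)) :=
  homotopy (pt (projT2 nO) t).
have -> : homotopy \o \pi_(realization R X)%qT = unstable.sigT_fun f.
  by apply/funext => -[[n O] t].
apply: sigT_continuous => -[n O]; have [x ->] := classP O.
have -> : f (existT _ n (class x)) = curry (fun ts : std_simplex R n * R =>
    contraction (graded_of x) (grade_weights x ts.1)
      (time_bound%:R * Num.max 0 ts.2)).
  by apply/funext => t; apply/funext => s; rewrite /f homotopyE.
exact: continuous_curry_fun (@contraction_simplex_continuous n x).
Qed.

Lemma homotopy_continuous : continuous (uncurry homotopy).
Proof.
apply: continuous_uncurry.
- exact: locally_compactR.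
- exact: norm_hausdorff.
- exact: homotopy_curry_continuous.
move=> u; have [n [w [t ->]]] := realization_ptP u; have [x ->] := classP w.
have -> : homotopy (pt (class x) t) = curry (fun ts : std_simplex R n * R =>
    contraction (graded_of x) (grade_weights x ts.1)
      (time_bound%:R * Num.max 0 ts.2)) t.
  by apply/funext => s; rewrite homotopyE.
exact: (continuous_curry (@contraction_simplex_continuous n x)).2.
Qed.

Lemma quotient_contractible : sset_contractible R X.
Proof.
exists base_point, (uncurry homotopy); split.
- exact/continuous_subspaceT/homotopy_continuous.
- exact: homotopy0.
- exact: homotopy1.
Qed.

End collection.

Theorem theorem3p2 (R : realType) (p : nat) (G : groupType) (C : set (set G))
    (p_prime : prime p) (Gfin : pseudo_finite_at G p)
    (CSp : C `<=` Sp G p) (C0 : C !=set0)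
    (Cconj : conj_closed C) (Cover : overgroup_closed p C) :
  (exists (M : matching (nerve_quotient Cconj)) (v : nerve_quotient Cconj 0),
     morse_matching M /\
     critical_cells M = [set existT _ 0%N v]) /\
  sset_contractible R (nerve_quotient Cconj).
Proof.
have [S Ssyl] := pseudo_finite_sylow Gfin; split.
  exists (quotient_matching p_prime Gfin CSp Cconj Cover Ssyl).
  eexists; split; first exact: quotient_matching_morse.
  exact: (quotient_matching_critical p_prime Gfin CSp Cconj Cover Ssyl C0).
exact: (quotient_contractible p_prime Gfin CSp Cconj Cover Ssyl C0).
Qed.
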